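(* There exists a universal constant $\kappa\in(0,\infty)$ with the following property. Let $\delta,\varepsilon\in(0,1)$ and $D\in[1,\infty)$ satisfy $\delta\le\kappa\varepsilon^2/(n^2D)$. Let $X,Y$ be Banach spaces with $\dim X=n<\infty$, let $\mathcal N_\delta$ be a $\delta$-net in $B_X$, and assume $c_Y(\mathcal N_\delta)\le D$. Then there exist a separable probability space $(\Omega,\nu)$, a finite dimensional linear subspace $Z\subseteq Y$, and a linear operator $T:X\to L_\infty(\nu,Z)$ such that for all $x\in X$, $$\frac{1-\varepsilon}{D}\|x\|_X\le\|Tx\|_{L_1(\nu,Z)}\le\|Tx\|_{L_\infty(\nu,Z)}\le(1+\varepsilon)\|x\|_X.$$
   Context: For metric spaces $(M,d_M),(N,d_N)$, the distortion $c_N(M)$ is the infimum over $D\in[1,\infty]$ for which there exist $g:M\to N$ and $s>0$ with $s\,d_M(x,y)\le d_N(g(x),g(y))\le Ds\,d_M(x,y)$ for all $x,y\in M$. A $\delta$-net in $B_X$ (the closed unit ball) is a subset $\mathcal N\subseteq B_X$ such that every $x\in B_X$ satisfies $\|x-p\|_X\le\delta$ for some $p\in\mathcal N$. For a measure space $(\Omega,\nu)$, Banach space $Z$ and $p\in[1,\infty]$, $L_p(\nu,Z)$ is the Bochner space of (classes of) measurable $h:\Omega\to Z$ with $\|h\|_{L_p(\nu,Z)}^p=\int_\Omega\|h\|_Z^p\,d\nu<\infty$ (essential supremum norm for $p=\infty$). *)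

(* Defs.v *)
From HB Require Import structures.
From mathcomp Require Import all_boot all_order all_algebra.
From mathcomp Require Import all_classical all_reals all_analysis.
From mathcomp Require Import Rstruct Rstruct_topology ess_sup_inf.
Set Implicit Arguments. Unset Strict Implicit. Unset Printing Implicit Defensive.
Import Order.TTheory GRing.Theory Num.Theory.
Import numFieldNormedType.Exports.
Local Open Scope classical_set_scope.
Local Open Scope ring_scope.

Notation RR := Rdefinitions.R.

Definition dim_eq (X : normedModType RR) (n : nat) : Prop :=
  exists b : 'I_n -> X, forall x : X, exists! c : 'I_n -> RR,
      x = \sum_(i < n) c i *: b i.

Definition is_net (X : normedModType RR) (delta : RR) (N : set X) : Prop :=
  N `<=` [set x | `|x| <= 1] /\
  forall x : X, `|x| <= 1 -> exists2 p, N p & `|x - p| <= delta.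

(* distortion c_Y(M) of the metric subspace M of X (induced metric) into Y,
   as an extended real (infimum of the empty set is +oo). *)
Definition distortion (Y X : normedModType RR) (M : set X) : \bar RR :=
  ereal_inf [set (Dd%:E)%E | Dd in [set Dd : RR | 1 <= Dd /\
     exists (g : X -> Y) (s : RR), 0 < s /\
       forall x y, M x -> M y ->
         s * `|x - y| <= `|g x - g y| /\ `|g x - g y| <= Dd * s * `|x - y|]].

(* separable measure space: the measure algebra has a countable dense family *)
Definition separable_prob d (T : measurableType d) (P : probability T RR) : Prop :=
  exists A : nat -> set T, (forall k, measurable (A k)) /\
    forall B : set T, measurable B -> forall e : RR, 0 < e ->
      exists k, (P ((A k `\` B) `|` (B `\` A k)) < e%:E)%E.

(* (strong/Borel) measurability of a vector valued map with values in a finite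
   dimensional subspace *)
Definition vmeasurable d (T : measurableType d) (Y : normedModType RR)
  (f : T -> Y) : Prop := forall U : set Y, open U -> measurable (f @^-1` U).

Definition span_fin (Y : normedModType RR) (m : nat) (z : 'I_m -> Y) : set Y :=
  [set y | exists c : 'I_m -> RR, y = \sum_(i < m) c i *: z i].

Definition L1norm d (T : measurableType d) (P : probability T RR)
  (Y : normedModType RR) (f : T -> Y) : \bar RR :=
  (\int[P]_w (`|f w|)%:E)%E.

Definition Linfnorm d (T : measurableType d) (P : probability T RR)
  (Y : normedModType RR) (f : T -> Y) : \bar RR :=
  ess_sup P (fun w => (`|f w|)%:E).

(* Main.v *)
Require Import Defs.
From HB Require Import structures.
From mathcomp Require Import all_boot all_order all_algebra.
From mathcomp Require Import all_classical all_reals all_analysis.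
From mathcomp Require Import Rstruct Rstruct_topology ess_sup_inf.
From mathcomp Require Import ring lra zify.
Set Implicit Arguments. Unset Strict Implicit. Unset Printing Implicit Defensive.
Import Order.TTheory GRing.Theory Num.Theory.
Import numFieldNormedType.Exports.
Local Open Scope classical_set_scope.
Local Open Scope ring_scope.

(* Almost extend the embedding [g] of the net to a map [F] that is nearly
   Lipschitz at all scales, and let [T x] be the derivative of [F] in direction
   [x] at a random point of a ball.  Everything is discretised: the space is
   replaced by a fine lattice [h (Z b_1 + ... + Z b_n)], [F] is the map
   "[g] at the nearest net point" averaged twice over a lattice ball of radius
   [tau ~ n delta / eps], the derivative is a difference quotient along the
   basis, and the probability space is a finite lattice ball of radius of order 1
   with the uniform measure.

   Volume enters only through the number of points of a ball that leave it under a
   translation by [-u], which is [O(n |u| / radius)] times its cardinality for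
   suitable radii.  This is also the number of maximal arithmetic progressions of
   step [u] in the ball.  Telescoping along these progressions turns the coarse
   Lipschitz bound (additive error [2 delta]) into a genuine one with relative
   error [n delta / tau], and turns the lower bound of the embedding on long
   chords into a lower bound for the mean of [|F (w + u) - F w|], at the cost of
   [n tau D] instead of the worse loss of a pointwise comparison.  Second
   differences of [F] are of second order in the mesh thanks to the double
   averaging, so the difference quotients are linear in the limit. *)

(** * Sums over a finite set cut into arithmetic progressions *)

Definition progression (A : zmodType) (u w : A) (l : nat) : seq A :=
  [seq w + u *+ j | j <- iota 0 l].

(* A pair [(w, l)] stands for the maximal progression [w, w + u, ..., w + (l - 1) u]
   inside [S]; its first element is one of those counted on the right. *)
Lemma runs_decomposition (A : zmodType) (u : A) (S : seq A) :
  uniq S -> (forall w, exists j, w + u *+ j \notin S) ->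
  (forall w, exists j, w - u *+ j \notin S) ->
  exists rs : seq (A * nat),
    [/\ perm_eq S (flatten [seq progression u r.1 r.2 | r <- rs]),
        (size rs <= count (fun w => (w - u)%R \notin S) S)%N &
        forall r, r \in rs -> r.1 \in S /\ exists2 l, r.2 = l.+1 & r.1 + u *+ l \in S].
Proof.
have [m] := ubnP (size S); elim: m S => // m IH [|x S'] ltSm uS fwd bwd.
  by exists [::]; split.
set S := x :: S' in ltSm uS fwd bwd *.
have xS : x \in S by rewrite mem_head.
(* Walking back from [x] in steps of [u] until [S] is left finds the first element [w] of the run of
   [x]; walking forward from [w] then finds its length. *)
have [a [a_out a_min]] : exists a, x - u *+ a \notin S /\
    forall j, (j < a)%N -> x - u *+ j \in S.
  have [a a_out a_min] := ex_minnP (bwd x); exists a; split=> // j ja.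
  by apply: contraTT ja => /a_min; rewrite -leqNgt.
case: a a_out a_min => [|a] a_out a_min; first by rewrite subr0 xS in a_out.
set w := x - u *+ a.
have wS : w \in S by exact: a_min.
have w_start : w - u \notin S by rewrite -addrA -opprD -mulrSr.
have [l [l_out l_min]] : exists l, w + u *+ l \notin S /\
    forall j, (j < l)%N -> w + u *+ j \in S.
  have [l l_out l_min] := ex_minnP (fwd w); exists l; split=> // j jl.
  by apply: contraTT jl => /l_min; rewrite -leqNgt.
case: l l_out l_min => [|l] l_out l_min; first by rewrite addr0 wS in l_out.
pose P := progression u w l.+1.
have PE y : (y \in P) -> exists2 j, (j <= l)%N & y = w + u *+ j.
  by case/mapP => j; rewrite mem_iota /= add0n ltnS => jl ->; exists j.
have PS y : y \in P -> y \in S by case/PE => j jl ->; apply: l_min.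
have wP : w \in P by rewrite /P /progression /= addr0 mem_head.
(* A repetition would make [u] a torsion element, and [w + u *+ l.+1], which lies outside [S], would
   equal an earlier term of the run. *)
have uP : uniq P.
  rewrite map_inj_in_uniq ?iota_uniq// => i j.
  wlog le_ij : i j / (i <= j)%N.
    by move=> H; case: (leqP i j) => [|/ltnW] le_ij hi hj e; [|symmetry]; apply: H.
  rewrite !mem_iota /= !add0n => il jl /addrI e.
  apply/eqP; rewrite eqn_leq le_ij /= leqNgt; apply/negP => lt_ij.
  have e0 : u *+ (j - i) = 0.
    by apply: (addrI (u *+ i)); rewrite -mulrnDr subnKC// e addr0.
  suff : w + u *+ l.+1 \in S by rewrite (negPf l_out).
  have -> : u *+ l.+1 = u *+ (l.+1 - (j - i)).
    rewrite -[in LHS](@subnK (j - i) l.+1) ?mulrnDr ?e0 ?addr0//.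
    exact: leq_trans (leq_subr _ _) (ltnW jl).
  apply: l_min; rewrite -subn_gt0 in lt_ij; lia.
pose S1 := [seq y <- S | y \notin P].
have S1E y : (y \in S1) = (y \notin P) && (y \in S) by rewrite mem_filter.
have perm1 : perm_eq S (P ++ S1).
  rewrite -(perm_filterC (mem P) S) perm_cat2r.
  apply: uniq_perm; rewrite ?filter_uniq// => y.
  rewrite mem_filter; apply: andb_idr; exact: PS.
have [|y|y|rs [permrs szrs prs]] := IH S1 _ (filter_uniq _ uS).
- rewrite ltnS in ltSm; apply: leq_trans ltSm.
  by rewrite (perm_size perm1) size_cat /= addSn ltnS leq_addl.
- by have [j yj] := fwd y; exists j; rewrite S1E (negPf yj) andbF.
- by have [j yj] := bwd y; exists j; rewrite S1E (negPf yj) andbF.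
exists ((w, l.+1) :: rs); split.
- by rewrite (perm_trans perm1)// [flatten _]/= perm_cat2l.
- apply: leq_ltn_trans szrs _.
  rewrite (permP perm1) count_cat.
  (* Removing [P] creates no new starting point: if [y - u] is in [P], then [y] is in [P] too or is
     the first point past its end, outside [S]. *)
  have -> : count (fun y => y - u \notin S1) S1 = count (fun y => y - u \notin S) S1.
    apply: eq_in_count => y; rewrite S1E => /andP[yP yS].
    rewrite S1E negb_and negbK orb_idl// => /PE[j jl e].
    have {}e : y = w + u *+ j.+1 by rewrite mulrSr addrA -e subrK.
    move: jl; rewrite leq_eqVlt => /predU1P[jl|jl].
      by rewrite e jl (negPf l_out) in yS.
    case/negP: yP; rewrite e; apply/mapP; exists j.+1 => //.
    by rewrite mem_iota.
  rewrite -[X in (X < _)%N]add0n ltn_add2r.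
  by rewrite -has_count; apply/hasP; exists w.
- move=> r; rewrite inE => /predU1P[->|/prs[]] /=.
    by split => //; exists l => //; apply: l_min.
  rewrite S1E => /andP[_ rS] [k rk]; rewrite S1E => /andP[_ kS].
  by split=> //; exists k.
Qed.

Lemma sumr_const_seq (V : zmodType) (I : Type) (s : seq I) (x : V) :
  \sum_(i <- s) x = x *+ size s.
Proof. by rewrite big_const_seq count_predT iter_addr_0. Qed.

Section TorsionFree.
Variables (R : realType) (A : zmodType) (X V : normedModType R).
Variable e : {additive A -> X}.
Hypothesis e_inj : forall k, e k = 0 -> k = 0.

(** Injectivity makes the norm of [e u] positive, so [e (w + u *+ j)] grows linearly in [j], while
    on [S] the norm of [e] is at most the sum [B]. *)
Lemma progression_escapes (S : seq A) (u w : A) :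
  u != 0 -> exists j, w + u *+ j \notin S.
Proof.
move=> u0.
have eu : 0 < `|e u| by rewrite normr_gt0; apply: contra_neq u0; exact: e_inj.
pose B := \sum_(s <- S) `|e s|.
have B0 : 0 <= B by exact: sumr_ge0.
exists (Num.truncn ((B + `|e w|) / `|e u|)).+1; set j := _.+1.
apply/negP => wS.
have : `|e (w + u *+ j)| <= B.
  rewrite /B (big_rem _ wS) /= lerDl; exact: sumr_ge0.
have hj : B + `|e w| < `|e u| *+ j.
  by rewrite -[ltRHS]mulr_natr mulrC -ltr_pdivrMr// truncnS_gt.
have : `|e u| *+ j <= `|e (w + u *+ j)| + `|e w|.
  rewrite -normrMn -raddfMn.
  by have -> : e (u *+ j) = e (w + u *+ j) - e w; [rewrite !raddfD/= addrAC subrr add0r|exact: ler_normB].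
lra.
Qed.

Lemma runs_of_torsion_free (u : A) (S : seq A) : uniq S -> u != 0 ->
  exists rs : seq (A * nat),
    [/\ perm_eq S (flatten [seq progression u r.1 r.2 | r <- rs]),
        (size rs <= count (fun w => (w - u)%R \notin S) S)%N &
        forall r, r \in rs -> r.1 \in S /\ exists2 l, r.2 = l.+1 & r.1 + u *+ l \in S].
Proof.
move=> uS u0; apply: runs_decomposition => // w; first exact: progression_escapes.
by have [|j hj] := @progression_escapes S (- u) w; [rewrite oppr_eq0|exists j; rewrite -mulNrn].
Qed.

Lemma sum_progression (f : A -> V) (u w : A) (l : nat) :
  \sum_(x <- progression u w l) (f (x + u) - f x) = f (w + u *+ l) - f w.
Proof.
rewrite big_map -[iota 0 l](_ : index_iota 0 l = _); last by rewrite /index_iota subn0.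
rewrite (eq_bigr (fun j => f (w + u *+ j.+1) - f (w + u *+ j))) => [|j _].
  by rewrite telescope_sumr// addr0.
by rewrite -addrA -mulrSr.
Qed.

Lemma size_runs (u : A) (S : seq A) (rs : seq (A * nat)) :
  perm_eq S (flatten [seq progression u r.1 r.2 | r <- rs]) ->
  (size S)%:R = \sum_(r <- rs) r.2%:R :> R.
Proof.
move=> /perm_size ->; rewrite size_flatten sumnE big_map big_map natr_sum.
by apply: eq_bigr => r _; rewrite size_map size_iota.
Qed.

(** Each run telescopes to a single difference, so the additive error [g] is paid once per run, and
    there are at most as many runs as boundary points. *)
Lemma norm_sum_diff_le (u : A) (S : seq A) (f : A -> V) (a g : R) :
  uniq S -> 0 <= a -> 0 <= g ->
  (forall w l, w \in S -> w + u *+ l \in S ->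
     `|f (w + u *+ l.+1) - f w| <= a * l.+1%:R + g) ->
  `|\sum_(w <- S) (f (w + u) - f w)| <=
    a * (size S)%:R + g * (count (fun w => (w - u)%R \notin S) S)%:R.
Proof.
move=> uS a0 g0 fS; have [->|u0] := eqVneq u 0.
  rewrite big1 => [|w _]; last by rewrite addr0 subrr.
  by rewrite normr0 addr_ge0// mulr_ge0.
have [rs [prs szrs rsP]] := runs_of_torsion_free uS u0.
rewrite (perm_big _ prs)/= big_flatten big_map.
rewrite (eq_bigr _ (fun r _ => sum_progression f u r.1 r.2)).
apply: (@le_trans _ _ (\sum_(r <- rs) (a * r.2%:R + g))).
  apply: le_trans (ler_norm_sum _ _ _) _; rewrite big_seq [leRHS]big_seq.
  by apply: ler_sum => r /rsP[rS [l -> lS]]; exact: fS.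
rewrite big_split/= -mulr_sumr -(size_runs prs) lerD2l.
by rewrite sumr_const_seq -[_ *+ _]mulr_natr ler_wpM2l// ler_nat.
Qed.

(** By the triangle inequality the sum of norms over a run dominates the norm of its telescoped
    total; the loss [g] is again charged once per run. *)
Lemma sum_norm_diff_ge (u : A) (S : seq A) (f : A -> V) (a g : R) :
  uniq S -> u != 0 -> 0 <= g ->
  (forall w l, w \in S -> w + u *+ l \in S ->
     a * l.+1%:R - g <= `|f (w + u *+ l.+1) - f w|) ->
  a * (size S)%:R - g * (count (fun w => (w - u)%R \notin S) S)%:R <=
  \sum_(w <- S) `|f (w + u) - f w|.
Proof.
move=> uS u0 g0 fS.
have [rs [prs szrs rsP]] := runs_of_torsion_free uS u0.
rewrite (perm_big _ prs)/= big_flatten big_map.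
apply: (@le_trans _ _ (\sum_(r <- rs) (a * r.2%:R - g))).
  rewrite big_split/= -mulr_sumr -(size_runs prs) lerD2l.
  by rewrite sumr_const_seq mulNrn lerN2 -[leLHS]mulr_natr ler_wpM2l// ler_nat.
rewrite big_seq [leRHS]big_seq; apply: ler_sum => r /rsP[rS [l rl lS]].
apply: le_trans (ler_norm_sum _ _ _).
by rewrite sum_progression rl; exact: fS.
Qed.

Definition average (S : seq A) (f : A -> V) (w : A) : V :=
  (size S)%:R^-1 *: \sum_(y <- S) f (w + y).

Lemma average_const (S : seq A) (c : V) (w : A) : (0 < size S)%N ->
  average S (fun=> c) w = c.
Proof.
move=> S0; rewrite /average sumr_const_seq -[c *+ _]scaler_nat scalerA mulVf ?scale1r//.
by rewrite pnatr_eq0 -lt0n.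
Qed.

Lemma averageB (S : seq A) (f g : A -> V) (w : A) :
  average S f w - average S g w = average S (fun x => f x - g x) w.
Proof. by rewrite /average -scalerBr -sumrB. Qed.

Lemma average_shift (S : seq A) (f : A -> V) (u w : A) :
  average S f (w + u) = average S (fun x => f (x + u)) w.
Proof. by rewrite /average; under eq_bigr do rewrite addrAC. Qed.

Lemma norm_average_le (S : seq A) (f : A -> V) (w : A) (a : R) : 0 <= a ->
  (forall y, y \in S -> `|f (w + y)| <= a) -> `|average S f w| <= a.
Proof.
move=> a0 fa; rewrite normrZ ger0_norm ?invr_ge0//.
have [S0|S0] := posnP (size S); first by rewrite S0 invr0 mul0r.
rewrite mulrC ler_pdivrMr ?ltr0n//; apply: le_trans (ler_norm_sum _ _ _) _.
rewrite mulr_natr -sumr_const_seq big_seq [leRHS]big_seq; exact: ler_sum.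
Qed.

(** [b] bounds the proportion of boundary points; after [norm_sum_diff_le] only this fraction of [g]
    survives the normalisation. *)
Lemma average_diff_le (S : seq A) (f : A -> V) (u w : A) (a g b : R) :
  uniq S -> (0 < size S)%N -> 0 <= a -> 0 <= g ->
  (count (fun w => (w - u)%R \notin S) S)%:R <= b * (size S)%:R ->
  (forall y l, y \in S -> y + u *+ l \in S ->
     `|f (w + (y + u *+ l.+1)) - f (w + y)| <= a * l.+1%:R + g) ->
  `|average S f (w + u) - average S f w| <= a + g * b.
Proof.
move=> uS S0 a0 g0 Sb fS.
rewrite average_shift averageB normrZ ger0_norm ?invr_ge0//.
rewrite mulrC ler_pdivrMr ?ltr0n//.
under eq_bigr do rewrite -addrA.
apply: le_trans (norm_sum_diff_le uS a0 g0 fS) _.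
by rewrite mulrDl lerD2l -mulrA ler_wpM2l.
Qed.
End TorsionFree.

(** * Lattice balls *)

Lemma bernoulli_ge (R : realType) (x : R) (t : nat) : -1 <= x ->
  1 + x * t%:R <= (1 + x) ^+ t.
Proof.
move=> x1; elim: t => [|t IH]; first by rewrite mulr0 addr0 expr0.
have x2 : 0 <= x ^+ 2 * t%:R by rewrite mulr_ge0// sqr_ge0.
rewrite exprS; apply: (@le_trans _ _ ((1 + x) * (1 + x * t%:R))).
  by rewrite -[t.+1]addn1 natrD; nra.
by rewrite ler_wpM2l// -[0](addrN 1) lerD2l.
Qed.

(* [r] minimises [K r * (1 - 4 / J) ^ r]; growth by at most [4 ^ n] over
   [M, 2 M] keeps the minimiser away from the left end. *)
Lemma regular_radius (R : realType) (K : nat -> nat) (n J : nat) :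
  let M := (2 * (n * J))%N in
  (0 < n)%N -> (5 <= J)%N -> {homo K : r s / (r <= s)%N} ->
  (forall r, (0 < K r)%N) -> (K (2 * M) <= 4 ^ n * K M)%N ->
  exists r, [/\ (M <= r)%N, (r <= 2 * M)%N & forall t, (t <= n * J)%N ->
     (K r)%:R * (1 - 4 / J%:R * t%:R) <= (K (r - t)%N)%:R :> R].
Proof.
move=> M n0 J5 Khomo K0 KM.
pose la : R := 4 / J%:R; pose mu : R := 1 - la.
have J0 : 0 < J%:R :> R by rewrite ltr0n; lia.
have la0 : 0 < la by rewrite divr_gt0.
have la1 : la < 1 by rewrite ltr_pdivrMr// mul1r (ltr_nat R 4 J).
have mu0 : 0 < mu by rewrite subr_gt0.
have mu1 : mu < 1 by rewrite ltrBlDr ltrDl.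
have mu_mono i j : (i <= j)%N -> mu ^+ j <= mu ^+ i.
  by move=> ij; rewrite ler_wiXn2l// ltW.
pose g r : R := (K r)%:R * mu ^+ r.
have [i _ i_min] := @arg_minP _ _ _ (ord0 : 'I_M.+1) xpredT (fun i => g (M + i)%N) isT.
have g_min r : (M <= r)%N -> (r <= 2 * M)%N -> g (M + i)%N <= g r.
  move=> Mr rM; have lt_r : (r - M < M.+1)%N by lia.
  by have := i_min (Ordinal lt_r) isT; rewrite /= subnKC.
(* Otherwise more than [n * J] factors [mu] separate [M + i] from [2 * M]. Each [J] of them give at
   most [1 / 5], which beats the growth [4 ^ n] and contradicts minimality. *)
have i_big : (n * J <= i)%N.
  rewrite leqNgt; apply/negP => i_small.
  have : g (M + i)%N <= g (2 * M)%N by apply: g_min; lia.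
  apply/negP; rewrite -ltNge /g.
  have KM' : (K (2 * M))%:R <= 4 ^+ n * (K (M + i)%N)%:R :> R.
    rewrite -natrX -natrM ler_nat; apply: leq_trans KM _.
    by rewrite leq_mul2l Khomo ?orbT// leq_addr.
  have KR0 : 0 < (K (M + i)%N)%:R :> R by rewrite ltr0n.
  have muJ : mu ^+ J * 5 <= 1.
    have mu_le : mu * (1 + la) <= 1 by rewrite /mu; nra.
    apply: (@le_trans _ _ (mu ^+ J * (1 + la) ^+ J)).
      rewrite ler_pM2l ?exprn_gt0//; apply: le_trans (bernoulli_ge _ _); last by lra.
      by rewrite /la divfK ?gt_eqF//; lra.
    rewrite -exprMn exprn_ile1// mulr_ge0//; lra.
  have mu_nJ : 4 ^+ n * mu ^+ (n * J) < 1.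
    rewrite mulnC exprM -exprMn exprn_ilt1// -?lt0n//; first by rewrite mulr_ge0// exprn_ge0// ltW.
    have : 0 < mu ^+ J by rewrite exprn_gt0.
    lra.
  apply: (@le_lt_trans _ _ ((4 ^+ n * mu ^+ (n * J)) * ((K (M + i)%N)%:R * mu ^+ (M + i)))).
    rewrite mulrACA -exprD; apply: ler_pM => //; first by rewrite exprn_ge0// ltW.
    by apply: mu_mono; lia.
  by rewrite gtr_pMl// mulr_gt0// exprn_gt0.
exists (M + i)%N; split; [lia|have := ltn_ord i; lia|move=> t tnJ].
(* Since [t <= i], the radius [M + i - t] is still a competitor; minimality gives the factor
   [mu ^+ t], which Bernoulli makes linear. *)
have Hg : g (M + i)%N <= g (M + i - t)%N by apply: g_min; have := ltn_ord i; lia.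
apply: (@le_trans _ _ ((K (M + i)%N)%:R * mu ^+ t)).
  rewrite ler_wpM2l//; have := @bernoulli_ge _ (- la) t; rewrite mulNr; apply; lra.
have mut : 0 < mu ^+ (M + i - t) by rewrite exprn_gt0.
rewrite -(ler_pM2r mut) -mulrA -exprD subnKC//; lia.
Qed.

Definition free_family (R : realType) (X : normedModType R) (n : nat)
    (b : 'I_n -> X) : Prop :=
  forall c : 'I_n -> R, \sum_(i < n) c i *: b i = 0 -> forall i, c i = 0.

(** The norm of the combination is continuous on the compact unit sphere of coordinates and does not
    vanish there; [C] is the inverse of its minimum. For [n = 0] the sphere is empty, hence the
    separate case. *)
Lemma free_family_coord_bound (R : realType) (X : normedModType R) (n : nat)
    (b : 'I_n -> X) : free_family b ->
  exists C : R, 0 < C /\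
    forall (c : 'I_n -> R) i, `|c i| <= C * `|\sum_(j < n) c j *: b j|.
Proof.
case: n b => [|n] b freeb; first by exists 1; split => // c [].
pose f (v : 'rV[R]_n.+1) := `|\sum_(j < n.+1) v ord0 j *: b j|.
have cg : continuous (fun v : 'rV[R]_n.+1 => \sum_(j < n.+1) v ord0 j *: b j).
  move=> v; apply: (@cvg_big _ _ +%R 0 xpredT (@add_continuous X) _ _ _
    (fun j (w : 'rV[R]_n.+1) => w ord0 j *: b j)) => [|j _].
    exact: nbhs_filter.
  by apply: cvgZr_tmp; [exact: nbhs_filter|exact: coord_continuous].
have cf : continuous f.
  by move=> v; apply: continuous_comp; [exact: cg|exact: norm_continuous].
pose S : set 'rV[R]_n.+1 := [set v | `|v| = 1].
have S0 : S !=set0.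
  exists (`|const_mx 1 : 'rV[R]_n.+1|^-1 *: const_mx 1); rewrite /S/=.
  rewrite normrZ normfV normr_id mulVf// normr_eq0.
  apply/eqP => /matrixP/(_ ord0 ord0)/eqP; rewrite !mxE.
  by rewrite oner_eq0.
have compS : compact S.
  apply: bounded_closed_compact.
    by exists 1; split => // M M1 v /= ->; exact: ltW.
  rewrite (_ : S = Num.norm @^-1` [set x : R | x = 1])//.
  apply: preimage_closed; last exact: closed_eq.
  by move=> v _; exact: norm_continuous.
have [v0 v0S fmin] := EVT_min_rV S0 compS (continuous_subspaceT cf).
have fv0 : 0 < f v0.
  rewrite normr_gt0; apply/eqP => /freeb v00.
  move: v0S; rewrite inE /S/= => v01.
  suff v0E : v0 = 0 by move: v01; rewrite v0E normr0 => /esym/eqP; rewrite oner_eq0.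
  by apply/rowP => j; rewrite v00 mxE.
exists (f v0)^-1; split; first by rewrite invr_gt0.
move=> c i; pose v : 'rV[R]_n.+1 := \row_j c j.
have vi : `|c i| <= `|v|.
  rewrite [leRHS]/Num.norm /= mx_normrE; apply/bigmax_geP; right => /=.
  by exists (ord0, i) => //=; rewrite mxE.
apply: le_trans vi _; have [->|v0'] := eqVneq v 0.
  by rewrite normr0 mulr_ge0// invr_ge0 ltW.
have nv : 0 < `|v| by rewrite normr_gt0.
have : f v0 <= f (`|v|^-1 *: v).
  by apply: fmin; rewrite inE /S/= normrZ normfV normr_id mulVf// gt_eqF.
have -> : f (`|v|^-1 *: v) = `|v|^-1 * `|\sum_(j < n.+1) c j *: b j|.
  rewrite /f -[in RHS](ger0_norm (ltW nv)) -normfV -normrZ scaler_sumr.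
  by congr `|_|; apply: eq_bigr => j _; rewrite !mxE scalerA.
rewrite mulrC ler_pdivlMr// => fle.
by rewrite mulrC ler_pdivlMr// mulrC.
Qed.

Section Lattice.
Variables (R : realType) (X : normedModType R) (n : nat) (b : 'I_n -> X).
Local Notation A := {ffun 'I_n -> int}.

(** The lattice is kept at mesh 1, so norms of its points are in mesh units; the scale [h] enters
    with the map on the lattice. *)
Definition latpt (k : A) : X := \sum_(i < n) (k i)%:~R *: b i.

Lemma latpt_is_zmod_morphism : zmod_morphism latpt.
Proof.
move=> k l; rewrite /latpt -sumrB; apply: eq_bigr => i _.
by rewrite !ffunE rmorphB scalerBl.
Qed.

HB.instance Definition _ :=
  GRing.isZmodMorphism.Build _ _ latpt latpt_is_zmod_morphism.

Hypothesis freeb : free_family b.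

Lemma latpt_inj (k : A) : latpt k = 0 -> k = 0.
Proof.
by move=> /freeb k0; apply/ffunP => i; apply/eqP; rewrite ffunE -(intr_eq0 R) k0.
Qed.

(** The coordinate bound places the ball inside a finite box of integer vectors. *)
Lemma lattice_ball_ex (r : nat) :
  exists s : seq A, uniq s /\ forall k, (k \in s) = (`|latpt k| <= r%:R).
Proof.
have [C [C0 Cb]] := free_family_coord_bound freeb.
pose P := (Num.truncn (C * r%:R)).+1.
pose T := {ffun 'I_n -> 'I_(2 * P).+1}.
pose box (d : T) : A := [ffun i => (d i)%:Z - P%:Z].
exists [seq k <- undup (map box (enum T)) | `|latpt k| <= r%:R]; split.
  by rewrite filter_uniq ?undup_uniq.
move=> k; rewrite mem_filter andb_idr// => kr; rewrite mem_undup.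
have kP i : `|k i| <= P%:Z.
  rewrite -(ler_int R) intr_norm; apply: le_trans (Cb (fun j => (k j)%:~R) i) _.
  by apply: (@le_trans _ _ (C * r%:R)); rewrite ?ler_pM2l// ltW// truncnS_gt.
apply/mapP; exists [ffun i => inord `|(k i + P%:Z)%R|%N]; first by rewrite mem_enum.
apply/ffunP => i; rewrite !ffunE inordK; have := kP i; lia.
Qed.

Definition lattice_ball (r : nat) : seq A := projT1 (cid (lattice_ball_ex r)).

Lemma lattice_ball_uniq r : uniq (lattice_ball r).
Proof. by rewrite /lattice_ball; case: cid => s []. Qed.

Lemma mem_lattice_ball r k : (k \in lattice_ball r) = (`|latpt k| <= r%:R).
Proof. by rewrite /lattice_ball; case: cid => s []. Qed.

Lemma lattice_ball_gt0 r : (0 < size (lattice_ball r))%N.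
Proof.
have : 0 \in lattice_ball r by rewrite mem_lattice_ball raddf0 normr0.
by case: lattice_ball.
Qed.

Lemma lattice_ball_homo :
  {homo (fun r => size (lattice_ball r)) : r s / (r <= s)%N}.
Proof.
move=> r s rs; apply: uniq_leq_size => [|k]; first exact: lattice_ball_uniq.
by rewrite !mem_lattice_ball => /le_trans; apply; rewrite ler_nat.
Qed.

(* Dividing the coordinates by 4 maps the ball of radius [2 * M] into the ball
   of radius [M]; the [4 ^ n] residues recover the point. *)
Lemma lattice_ball_growth (M : nat) : 2 * \sum_(i < n) `|b i| <= M%:R ->
  (size (lattice_ball (2 * M)) <= 4 ^ n * size (lattice_ball M))%N.
Proof.
move=> bM; pose T := {ffun 'I_n -> 'I_4}.
pose quo (k : A) : A := [ffun i => (k i %/ 4)%Z].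
pose rm (k : A) : T := [ffun i => inord `|(k i %% 4)%Z|%N].
have rmE (k : A) i : (k i %% 4)%Z = (rm k i : nat)%:Z.
  rewrite ffunE inordK; lia.
pose F (k : A) := (quo k, rm k).
have F_inj : injective F.
  move=> k l [/ffunP q /ffunP m]; apply/ffunP => i.
  rewrite (divz_eq (k i) 4) (divz_eq (l i) 4) !rmE m.
  by have := q i; rewrite !ffunE => ->.
rewrite -(size_map F).
apply: (@leq_trans (size (allpairs pair (lattice_ball M) (enum T)))); last first.
  rewrite size_allpairs mulnC leq_mul2r -cardE card_ffun !card_ord leqnn.
  by rewrite orbT.
apply: uniq_leq_size; first by rewrite map_inj_uniq// lattice_ball_uniq.
move=> _ /mapP[k + ->]; rewrite mem_lattice_ball => kM.
apply: allpairs_f; last by rewrite mem_enum.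
rewrite mem_lattice_ball.
have kE : 4 *: latpt (quo k) = latpt k - \sum_(i < n) (rm k i)%:R *: b i.
  rewrite /latpt scaler_sumr -sumrB; apply: eq_bigr => i _.
  rewrite scalerA [in RHS](divz_eq (k i) 4) rmE ffunE rmorphD rmorphM/=.
  by rewrite -scalerBl addrK mulrC.
(* The residues contribute at most [2 * M], so the quotient has norm at most
   [(2 * M + 2 * M) / 4 = M]. *)
have : `|4 *: latpt (quo k)| <= (2 * M)%:R + 2 * M%:R.
  rewrite kE; apply: le_trans (ler_normB _ _) _; apply: lerD => //.
  apply: le_trans (ler_norm_sum _ _ _) _.
  apply: (@le_trans _ _ (4 * \sum_(i < n) `|b i|)); last by lra.
  rewrite mulr_sumr; apply: ler_sum => i _; rewrite normrZ ler_wpM2r// ger0_norm//.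
  by rewrite (ler_nat R _ 4) ltnW.
rewrite normrZ ger0_norm// natrM; lra.
Qed.

(** Points of the ball of radius [r - t] stay in the ball of radius [r] when moved by [-u], as soon
    as [t] exceeds the norm of [u]. The [+ 1] pays for rounding that norm up to an integer [t]. *)
Lemma regular_lattice_ball (J : nat) : (0 < n)%N -> (5 <= J)%N ->
  \sum_(i < n) `|b i| <= (n * J)%:R ->
  exists r, [/\ (2 * (n * J) <= r)%N, (r <= 4 * (n * J))%N &
    forall u, `|latpt u| + 1 <= (n * J)%:R ->
     (count (fun w => (w - u)%R \notin lattice_ball r) (lattice_ball r))%:R <=
     4 / J%:R * (`|latpt u| + 1) * (size (lattice_ball r))%:R :> R].
Proof.
move=> n0 J5 bJ.
have [|r [r1 r2 rP]] := @regular_radius R (fun r => size (lattice_ball r)) n J n0 J5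
  lattice_ball_homo lattice_ball_gt0.
  by apply: lattice_ball_growth; rewrite natrM; lra.
exists r; split => //; first by move: r2; lia.
move=> u uJ; pose t := (Num.truncn `|latpt u|).+1.
have ut : `|latpt u| < t%:R by rewrite truncnS_gt.
have tu : t%:R <= `|latpt u| + 1 by rewrite /t -natr1 lerD2r truncn_le.
have tJ : (t <= n * J)%N by rewrite -(ler_nat R); exact: le_trans uJ.
have tr : (t <= r)%N by lia.
have inner : (size (lattice_ball (r - t)) <=
    count (fun w => (w - u)%R \in lattice_ball r) (lattice_ball r))%N.
  rewrite -size_filter; apply: uniq_leq_size => [|w]; first exact: lattice_ball_uniq.
  rewrite mem_filter !mem_lattice_ball natrB// => wr.
  apply/andP; split; last by apply: le_trans wr _; rewrite gerBl.
  rewrite raddfB; apply: le_trans (ler_normB _ _) _; lra.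
have := count_predC (fun w => (w - u)%R \in lattice_ball r) (lattice_ball r).
move=> /(congr1 (fun m => m%:R : R)); rewrite natrD.
set c1 := count _ _; rewrite -[count (predC _) _]/(count (fun w => (w - u)%R \notin lattice_ball r) (lattice_ball r)).
set c2 := count _ _ => cE.
have := rP t tJ; rewrite -(ler_nat R) in inner => Hr.
have J0 : 0 <= 4 / J%:R :> R by rewrite divr_ge0.
have K0 : 0 <= (size (lattice_ball r))%:R :> R by [].
have : 4 / J%:R * t%:R * (size (lattice_ball r))%:R <= 4 / J%:R * (`|latpt u| + 1) * (size (lattice_ball r))%:R.
  by rewrite ler_wpM2r// ler_wpM2l.
rewrite -/c1 in inner; move: Hr inner cE; rewrite mulrBr mulr1 [X in _ - X]mulrC; lra.
Qed.
End Lattice.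

(** * Averaging a coarse Lipschitz map *)

Section Smoothing.
Variables (R : realType) (A : zmodType) (X V : normedModType R).
Variable e : {additive A -> X}.
Hypothesis e_inj : forall k, e k = 0 -> k = 0.

Lemma latticeN_D k l : `|e (k + l)| <= `|e k| + `|e l|.
Proof. by rewrite raddfD; exact: ler_normD. Qed.

Definition coarse_lipschitz (h g Rm : R) (f : A -> V) : Prop :=
  forall k l, `|e k| <= Rm -> `|e l| <= Rm -> `|f k - f l| <= h * `|e (k - l)| + g.

(** What the averaging needs from a regular ball: [la] is the boundary proportion per unit of
    translation, valid for translations of length at most [L - 1]. *)
Definition small_boundary (S : seq A) (r la L : R) : Prop :=
  [/\ uniq S, (0 < size S)%N, forall y, y \in S -> `|e y| <= r &
    forall u, `|e u| + 1 <= L ->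
     (count (fun w => (w - u)%R \notin S) S)%:R <= la * (`|e u| + 1) * (size S)%:R].

Section Kernel.
Variables (S : seq A) (r la L h g Rm : R) (f : A -> V).
Hypothesis S_reg : small_boundary S r la L.
Hypotheses (h0 : 0 <= h) (g0 : 0 <= g).
Hypothesis f_lip : coarse_lipschitz h g Rm f.

(** An average of translates inherits both constants; only the domain shrinks, by the radius [r] of
    [S]. *)
Lemma average_coarse_lipschitz : coarse_lipschitz h g (Rm - r) (average S f).
Proof.
have [uS S0 Sr _] := S_reg.
move=> k l kR lR.
have -> : average S f k = average S (fun x => f (x + (k - l))) l.
  by rewrite -average_shift addrC subrK.
rewrite averageB.
apply: norm_average_le => [|y /Sr yr]; first by rewrite addr_ge0// mulr_ge0.
have -> : k - l = (l + y + (k - l)) - (l + y) by rewrite [RHS]addrC addKr.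
rewrite {1}[_ + (l + y + (k - l) - (l + y))]addrC subrK.
apply: f_lip.
  have -> : l + y + (k - l) = k + y by rewrite addrAC [l + _]addrC subrK.
  by have := latticeN_D k y; lra.
by have := latticeN_D l y; lra.
Qed.

(** The additive error [g] survives only on the boundary of [S], so a small [la] turns it into an
    error relative to the step. *)
Lemma average_step (u w : A) : `|e w| + r + `|e u| <= Rm -> `|e u| + 1 <= L ->
  `|average S f (w + u) - average S f w| <= h * `|e u| + g * (la * (`|e u| + 1)).
Proof.
have [uS S0 Sr SL] := S_reg; move=> wR uL.
apply: (average_diff_le e_inj) => //; [by rewrite mulr_ge0|exact: SL|].
move=> y l /Sr yr /Sr ylr.
have -> : h * `|e u| * l.+1%:R = h * `|e (w + (y + u *+ l.+1) - (w + y))|.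
  have -> : w + (y + u *+ l.+1) - (w + y) = u *+ l.+1.
    by rewrite addrA [X in X - _]addrC addrK.
  by rewrite raddfMn normrMn -[in RHS]mulr_natr mulrA.
have u_ge0 : 0 <= `|e u| by [].
apply: f_lip; last by have := latticeN_D w y; lra.
have := latticeN_D w (y + u *+ l.+1); have := latticeN_D (y + u *+ l) u.
by rewrite -addrA -mulrSr; lra.
Qed.

Lemma average_close (w : A) : `|e w| + r <= Rm ->
  `|average S f w - f w| <= h * r + g.
Proof.
have [uS S0 Sr SL] := S_reg; move=> wR.
have r0 : 0 <= r.
  by case: (S) S0 Sr => // y s _ /(_ y); rewrite mem_head => /(_ isT); apply: le_trans.
rewrite -[X in _ - X](average_const (f w) w S0) averageB.
apply: norm_average_le => [|y /Sr yr]; first by rewrite addr_ge0// mulr_ge0.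
apply: le_trans (f_lip _ _) _.
- by have := latticeN_D w y; lra.
- by lra.
- by rewrite addrAC subrr add0r lerD2r ler_wpM2l.
Qed.
End Kernel.

(** The first difference of [f] in direction [v] is itself averaged. Being bounded by [a], it is
    coarse Lipschitz with slope 0 and additive error [2 * a], of which only the boundary fraction
    remains. *)
Lemma average_second_diff (S : seq A) (r la L a Rm : R) (f : A -> V) (u v w : A) :
  small_boundary S r la L ->
  (forall x, `|e x| <= Rm -> `|f (x + v) - f x| <= a) -> 0 <= a ->
  `|e w| + r + `|e u| <= Rm -> `|e u| + 1 <= L ->
  `|(average S f (w + u + v) - average S f (w + u)) -
    (average S f (w + v) - average S f w)| <= 2 * a * (la * (`|e u| + 1)).
Proof.
move=> [uS S0 Sr SL] fa a0 wR uL.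
have u_ge0 : 0 <= `|e u| by [].
rewrite average_shift averageB (average_shift _ _ v) averageB.
rewrite -[leRHS]add0r; apply: (average_diff_le e_inj) => //; [by rewrite mulr_ge0|exact: SL|].
move=> y l /Sr yr /Sr ylr; rewrite mul0r add0r mulr_natl mulr2n.
apply: le_trans (ler_normB _ _) _; apply: lerD; apply: fa.
  have := latticeN_D w (y + u *+ l.+1); have := latticeN_D (y + u *+ l) u.
  by rewrite -addrA -mulrSr; lra.
by have := latticeN_D w y; lra.
Qed.

(** Induction on the word: each letter costs [t] for the failure of additivity and [t'] for the gap
    between [phi] and [T] on it. The bound [W] keeps all partial sums in range. *)
Lemma near_additive_sum (phi : A -> V) (T : {additive A -> V}) (vs : seq A)
    (t t' W : R) : phi 0 = 0 ->
  (forall v x, v \in vs -> `|e x| <= W -> `|phi (x + v) - phi x - phi v| <= t) ->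
  (forall v, v \in vs -> `|phi v - T v| <= t') ->
  \sum_(v <- vs) `|e v| <= W ->
  `|phi (\sum_(v <- vs) v) - T (\sum_(v <- vs) v)| <= (size vs)%:R * (t + t').
Proof.
move=> phi0; elim: vs => [|v vs IH] Ht Ht' HW.
  by rewrite big_nil raddf0 phi0 subr0 normr0 mul0r.
rewrite !big_cons in HW *; set s := \sum_(j <- vs) j in IH *.
have vW : \sum_(x <- vs) `|e x| <= W by apply: le_trans HW; rewrite lerDr.
have sW : `|e s| <= W.
  by apply: le_trans vW; rewrite /s raddf_sum; exact: ler_norm_sum.
have {}IH : `|phi s - T s| <= (size vs)%:R * (t + t').
  apply: IH => // [x y xvs|x xvs]; [apply: Ht|apply: Ht'];
  by rewrite inE xvs orbT.
have h1 := Ht v s (mem_head _ _) sW; have h2 := Ht' v (mem_head _ _).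
have split3 (a b c p q : V) : a - (p + q) = (a - b - c) + (c - p) + (b - q).
  by rewrite [_ + (c - p)]addrA subrK [a - b - p]addrAC [RHS]addrA subrK opprD addrA.
rewrite raddfD [v + s]addrC (split3 _ (phi s) (phi v)).
apply: le_trans (ler_normD _ _) _; rewrite /= -natr1 mulrDl mul1r [leRHS]addrC.
apply: lerD => //; apply: le_trans (ler_normD _ _) _; exact: lerD.
Qed.
End Smoothing.

(** * Words in unit vectors and discrete gradients *)

Section UnitVectors.
Variable n : nat.
Local Notation A := {ffun 'I_n -> int}.

Definition unitv (i : 'I_n) : A := [ffun j => (j == i)%:R].

Lemma sum_unitv (k : A) : \sum_(i < n) unitv i *~ k i = k.
Proof.
apply/ffunP => j; rewrite sum_ffunE (bigD1 j)//= big1 => [|i ij].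
  by rewrite addr0 ffunMzE ffunE eqxx intz.
by rewrite ffunMzE ffunE eq_sym (negPf ij) mul0rz.
Qed.

Lemma unitv_word (k : A) : exists vs : seq A,
  [/\ \sum_(v <- vs) v = k, size vs = (\sum_(i < n) `|k i|)%N &
      forall v, v \in vs -> exists i, v = unitv i \/ v = - unitv i].
Proof.
pose wd i := nseq `|k i|%N (unitv i *~ Num.sg (k i)).
exists (flatten [seq wd i | i <- index_enum 'I_n]); split.
- rewrite big_flatten big_map -[RHS]sum_unitv; apply: eq_bigr => i _.
  rewrite big_nseq iter_addr_0 pmulrn -mulrzA; congr (_ *~ _).
  by rewrite mulrC; case: (k i) => [[|m]|m]//=; rewrite ?mulr1 ?mulr0//; lia.
- rewrite size_flatten sumnE !big_map; apply: eq_bigr => i _; exact: size_nseq.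
- move=> v /flatten_mapP[i _]; rewrite mem_nseq => /andP[k0 /eqP ->]; exists i.
  case: (k i) k0 => [[|m]|m] _ //=; [by left; rewrite mulr0z..|by left|by right; rewrite mulrN1z].
Qed.

Definition gradient (R : realType) (V : normedModType R) (f : A -> V) (w : A)
    (c : 'I_n -> R) : V :=
  \sum_(i < n) c i *: (f (w + unitv i) - f w).

(** Integer directions give an additive map on the lattice, the shape that [near_additive_sum] asks
    of [T]. *)
Definition igradient (R : realType) (V : normedModType R) (f : A -> V) (w k : A) : V :=
  gradient f w (fun i => (k i)%:~R).

Lemma igradient_is_zmod_morphism (R : realType) (V : normedModType R) f w :
  zmod_morphism (@igradient R V f w).
Proof.
move=> k l; rewrite /igradient /gradient -sumrB; apply: eq_bigr => i _.
by rewrite !ffunE rmorphB scalerBl.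
Qed.

HB.instance Definition _ (R : realType) (V : normedModType R) f w :=
  GRing.isZmodMorphism.Build _ _ (@igradient R V f w)
    (@igradient_is_zmod_morphism R V f w).

Lemma igradient_unitv (R : realType) (V : normedModType R) (f : A -> V) w i :
  igradient f w (unitv i) = f (w + unitv i) - f w.
Proof.
rewrite /igradient /gradient (bigD1 i)//= big1 ?addr0 => [|j ji].
  by rewrite ffunE eqxx scale1r.
by rewrite ffunE (negPf ji) scale0r.
Qed.
End UnitVectors.

(** * Estimates for the doubly averaged map *)

Section Estimates.
Variables (R : realType) (A : zmodType) (X V : normedModType R).
Variables (e : {additive A -> X}) (I : Type) (d : I -> A) (B : R).
Hypothesis e_inj : forall k, e k = 0 -> k = 0.
Hypotheses (B0 : 0 <= B) (e_unitv : forall i, `|e (d i)| <= B).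
Variables (G : A -> V) (h g D tau sg W L Rm : R).
Variables (S1 S2 : seq A) (r1 r2 la1 la2 : R).
Hypothesis S1_reg : small_boundary e S1 r1 la1 L.
Hypothesis S2_reg : small_boundary e S2 r2 la2 L.
Hypotheses (h0 : 0 < h) (g0 : 0 <= g) (D1 : 1 <= D) (sg0 : 0 <= sg) (sg1 : sg <= 1).
(** [sgE] makes [sg] the relative error left of [g] by the boundary of [S1]; [tau] bounds the
    averaging radius in the metric of [X]; [regRm] keeps the points met below where the bounds on
    [G] hold. *)
Hypotheses (la10 : 0 <= la1) (sgE : g * la1 = h * sg) (r1tau : h * r1 <= tau).
Hypotheses (WL : W + 1 <= L) (BW : B <= W) (regRm : r2 + 2 * W + 2 * r1 <= Rm).
Hypothesis G_upper : coarse_lipschitz e h g Rm G.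
Hypothesis G_lower : forall k l, `|e k| <= Rm -> `|e l| <= Rm ->
  (h * `|e (k - l)| - g) / D <= `|G k - G l|.

Lemma small_boundary_ge0 S r la l : small_boundary e S r la l -> 0 <= r.
Proof.
case=> _ S0 Sr _; case: S S0 Sr => // y s _ /(_ y); rewrite mem_head => /(_ isT).
exact: le_trans.
Qed.

Let r10 : 0 <= r1. Proof. exact: small_boundary_ge0 S1_reg. Qed.
Let tau0 : 0 <= tau. Proof. by apply: le_trans r1tau; rewrite mulr_ge0// ltW. Qed.

(** The inner average controls single steps; the outer one converts that control into small second
    differences. *)
Definition smoothed : A -> V := average S1 (average S1 G).
Local Notation F := smoothed.

Lemma once_smoothed_step (w u : A) : `|e w| + r1 + `|e u| <= Rm -> `|e u| <= W ->
  `|average S1 G (w + u) - average S1 G w| <= h * (`|e u| + sg * (`|e u| + 1)).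
Proof.
(* [lra] only uses the local context, hence the copies of section hypotheses. *)
move: (WL) => WL'.
move=> wR uW; rewrite mulrDr [h * (sg * _)]mulrA -sgE -mulrA.
by apply: (average_step e_inj S1_reg (ltW h0) g0 G_upper) => //; lra.
Qed.

Lemma smoothed_step (w u : A) : `|e w| <= r2 + W -> `|e u| <= W ->
  `|F (w + u) - F w| <= h * (`|e u| + sg * (`|e u| + 1)).
Proof.
move: (WL) (regRm) => WL' regRm'.
move=> wR uW; rewrite mulrDr [h * (sg * _)]mulrA -sgE -mulrA.
have := average_coarse_lipschitz S1_reg (ltW h0) g0 G_upper => H_lip.
by apply: (average_step e_inj S1_reg (ltW h0) g0 H_lip) => //; lra.
Qed.

(** Each of the two averages moves values by at most [h * r1 + g]. *)
Lemma smoothed_close (w : A) : `|e w| <= r2 + 2 * W -> `|F w - G w| <= 2 * (tau + g).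
Proof.
move: (regRm) (r1tau) (r10) => regRm' r1tau' r10'.
move=> wR.
have := average_coarse_lipschitz S1_reg (ltW h0) g0 G_upper => H_lip.
have h1 : `|F w - average S1 G w| <= h * r1 + g.
  by apply: (average_close S1_reg (ltW h0) g0 H_lip); lra.
have h2 : `|average S1 G w - G w| <= h * r1 + g.
  by apply: (average_close S1_reg (ltW h0) g0 G_upper); lra.
by have := ler_distD (average S1 G w) (F w) (G w); lra.
Qed.

(** Steps of the inner average along [d i] are at most [h * (2 * B + 1)], so [average_second_diff]
    bounds the second differences of [F]; these are then summed along the word. *)
Lemma smoothed_additive (w : A) (T : {additive A -> V}) (vs : seq A) :
  (forall i, T (d i) = F (w + d i) - F w) ->
  (forall v, v \in vs -> exists i, v = d i \/ v = - d i) ->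
  `|e w| <= r2 -> (size vs)%:R * B <= W ->
  `|F (w + \sum_(v <- vs) v) - F w - T (\sum_(v <- vs) v)| <=
    (size vs)%:R * (2 * (2 * (h * (2 * B + 1)) * (la1 * (W + 1)))).
Proof.
move: (B0) (sg0) (sg1) (WL) (BW) (regRm) (r10) => B0' sg0' sg1' WL' BW' regRm' r10'.
move=> Td vsP wR vsW.
have vB v i : v = d i \/ v = - d i -> `|e v| <= B.
  by case=> ->; rewrite ?raddfN/= ?normrN; exact: e_unitv.
set t := 2 * (h * _) * _.
have t0 : 0 <= t by rewrite !mulr_ge0// ltW//; lra.
have second v x i : v = d i \/ v = - d i -> `|e x| <= W ->
    `|F (w + (x + v)) - F w - (F (w + x) - F w) - (F (w + v) - F w)| <= t.
  move=> vE xW; have vB' := vB _ _ vE.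
  have -> : F (w + (x + v)) - F w - (F (w + x) - F w) = F (w + x + v) - F (w + x).
    by rewrite addrA opprB addrA subrK.
  apply: (@le_trans _ _ (2 * (h * (2 * B + 1)) * (la1 * (`|e x| + 1)))); last first.
    by rewrite ler_wpM2l ?ler_wpM2l ?lerD2r// mulr_ge0// mulr_ge0 ?(ltW h0)//; lra.
  apply: (average_second_diff e_inj (Rm := r2 + W + r1) S1_reg) => //.
  - move=> y yR; apply: le_trans (once_smoothed_step _ _) _; [lra|lra|].
    by rewrite ler_pM2l//; nra.
  - by rewrite mulr_ge0 ?(ltW h0)//; lra.
  - lra.
  - lra.
rewrite [2 * _]mulr_natl mulr2n.
apply: (near_additive_sum (e := e) (T := T)
  (phi := fun x => F (w + x) - F w) (W := W)).
- by rewrite addr0 subrr.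
- by move=> v x /vsP[i vE] xW; exact: second vE xW.
- move=> v /vsP[i [->|->]]; first by rewrite Td subrr normr0.
  rewrite raddfN Td opprK.
  (* For a negative letter, the second difference based at [d i] in direction [- d i] compares the
     backward difference with minus the forward one. *)
  have := second (- d i) (d i) i (or_intror erefl).
  rewrite subrr addr0 subrr sub0r -opprD normrN addrC; apply.
  exact: le_trans (e_unitv i) BW.
- apply: le_trans vsW; rewrite mulr_natl -sumr_const_seq big_seq [leRHS]big_seq.
  by apply: ler_sum => v /vsP[i /vB].
Qed.

(** On a whole run the lower bound for [G] passes to [F] at a cost of [2 * (tau + g)] at each end,
    plus [g / D <= g]. This total [5 * g + 4 * tau] is charged once per run in [S2]. *)
Lemma smoothed_sum_ge (u : A) : u != 0 -> `|e u| <= W ->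
  (size S2)%:R * (h * `|e u| / D - la2 * (`|e u| + 1) * (5 * g + 4 * tau)) <=
  \sum_(w <- S2) `|F (w + u) - F w|.
Proof.
move: (g0) (D1) (tau0) (B0) (WL) (BW) (regRm) (r10) => g0' D1' tau0' B0' WL' BW' regRm' r10'.
have [uS _ S2r S2L] := S2_reg; move=> u0 uW.
have u_ge0 : 0 <= `|e u| by [].
have gt0 : 0 <= 5 * g + 4 * tau by lra.
have D0 : 0 < D by lra.
have := @sum_norm_diff_ge R A X V e e_inj u S2 F (h * `|e u| / D) (5 * g + 4 * tau) uS u0 gt0.
move=> /(_ _) H; apply: le_trans (H _).
  rewrite mulrBr [_ * (h * _ / D)]mulrC lerD2l lerN2.
  apply: le_trans (ler_wpM2l gt0 (S2L u _)) _; first lra.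
  by rewrite le_eqVlt; apply/orP; left; apply/eqP; ring.
move=> w l /S2r wr /S2r wlr.
have endW : `|e (w + u *+ l.+1)| <= r2 + W.
  by have := latticeN_D e (w + u *+ l) u; rewrite -addrA -mulrSr; lra.
have c1 := smoothed_close (w := w + u *+ l.+1) ltac:(lra).
have c2 := smoothed_close (w := w) ltac:(lra).
have := G_lower (k := w + u *+ l.+1) (l := w) ltac:(lra) ltac:(lra).
have -> : w + u *+ l.+1 - w = u *+ l.+1 by rewrite addrC addKr.
rewrite raddfMn normrMn -[`|e u| *+ _]mulr_natr mulrBl.
have gD : g / D <= g by rewrite ler_pdivrMr// ler_peMr.
have := ler_distD (F (w + u *+ l.+1)) (G (w + u *+ l.+1)) (G w).
have := ler_distD (F w) (F (w + u *+ l.+1)) (G w).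
rewrite distrC in c1.
have -> : h * (`|e u| * l.+1%:R) / D = h * `|e u| / D * l.+1%:R by ring.
lra.
Qed.
End Estimates.

(** * Lattice approximation of directions and choice of scales *)

Lemma latpt_unitv (R : realType) (X : normedModType R) n (b : 'I_n -> X) i :
  latpt b (unitv i) = b i.
Proof.
rewrite /latpt (bigD1 i)//= big1 ?addr0 => [|j ji].
  by rewrite ffunE eqxx scale1r.
by rewrite ffunE (negPf ji) scale0r.
Qed.

(** [k] is the coordinatewise floor of [Q * c], so rounding moves the vector by at most the sum of
    the norms of the [b i]. *)
Lemma lattice_direction (R : realType) (X : normedModType R) n (b : 'I_n -> X)
    (c : 'I_n -> R) (Q C : R) :
  `|\sum_(i < n) c i *: b i| = 1 -> 0 <= Q -> (forall i, `|c i| <= C) ->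
  exists k : {ffun 'I_n -> int},
    [/\ forall i, 0 <= Q * c i - (k i)%:~R <= 1,
        `|latpt b k| <= Q + \sum_(i < n) `|b i|,
        Q - \sum_(i < n) `|b i| <= `|latpt b k| &
        (\sum_(i < n) `|k i|%N)%:R <= n%:R * (Q * C + 1)].
Proof.
move=> x1 Q0 cC; pose k : {ffun 'I_n -> int} := [ffun i => Num.floor (Q * c i)].
have kE i : 0 <= Q * c i - (k i)%:~R <= 1.
  rewrite ffunE; have := floor_le (Q * c i); have := floorD1_gt (Q * c i).
  by rewrite intrD; lra.
have : `|Q *: \sum_(i < n) c i *: b i - latpt b k| <= \sum_(i < n) `|b i|.
  rewrite scaler_sumr /latpt -sumrB; apply: le_trans (ler_norm_sum _ _ _) _.
  apply: ler_sum => i _; rewrite scalerA -scalerBl normrZ ler_piMl//.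
  by have /andP[? ?] := kE i; rewrite ger0_norm.
set x := \sum_(i < n) c i *: b i in x1 * => Qxk.
have nQx : `|Q *: x| = Q by rewrite normrZ x1 mulr1 ger0_norm.
exists k; split => //.
- have := ler_normB (Q *: x) (Q *: x - latpt b k); rewrite opprB addrC subrK; lra.
- have := ler_normD (latpt b k) (Q *: x - latpt b k); rewrite addrC subrK; lra.
- rewrite natr_sum mulr_natl -[X in _ *+ X]card_ord -sumr_const; apply: ler_sum => i _.
  have ci : `|Q * c i| <= Q * C by rewrite normrM ger0_norm// ler_wpM2l.
  have -> : `|k i|%N%:R = `|(k i)%:~R| :> R by rewrite natr_absz intr_norm.
  have := kE i; move: ci; rewrite !ler_norml; lra.
Qed.

(** [t] is the failure of additivity along [k]; [n * a] is the cost of rounding [Q * c] to [k], one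
    step per coordinate. *)
Lemma gradient_close (R : realType) (V : normedModType R) (n : nat)
    (F : {ffun 'I_n -> int} -> V) (w k : {ffun 'I_n -> int}) (c : 'I_n -> R)
    (Q a t : R) : (forall i, 0 <= Q * c i - (k i)%:~R <= 1) ->
  (forall i, `|F (w + unitv i) - F w| <= a) ->
  `|F (w + k) - F w - igradient F w k| <= t ->
  `|Q *: gradient F w c - (F (w + k) - F w)| <= t + n%:R * a.
Proof.
move=> kE Fa Ft.
rewrite -(subrK (igradient F w k) (Q *: gradient F w c)) -addrA.
apply: le_trans (ler_normD _ _) _; rewrite [leRHS]addrC.
apply: lerD; last by rewrite distrC.
rewrite /igradient /gradient scaler_sumr -sumrB.
apply: le_trans (ler_norm_sum _ _ _) _.
rewrite mulr_natl -[X in _ *+ X]card_ord -sumr_const; apply: ler_sum => i _.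
rewrite scalerA -scalerBl normrZ; have /andP[k0 k1] := kE i.
by rewrite ger0_norm//; apply: le_trans (Fa i); rewrite ler_piMl.
Qed.

(* [h] is the mesh; [n J1] and [n J2] are, up to constants, the radii in mesh units
   of the averaging ball and of the ball of base points. *)
Lemma scale_choice (R : realType) (n : nat) (tau B W P : R) : (0 < n)%N ->
  0 < tau -> tau <= 1 -> 0 <= B -> 0 <= W -> 0 <= P ->
  exists (h : R) (J1 J2 : nat),
    [/\ 0 < h,
        [/\ (5 <= J1)%N, B <= (n * J1)%:R, W + 1 <= (n * J1)%:R,
            4 * (n * J1)%:R * h = tau & 4 / J1%:R * P <= 1] &
        [/\ (5 <= J2)%N, B <= (n * J2)%:R, W + 1 <= (n * J2)%:R,
            8 * (n * J2)%:R * h <= 1 /\ 16 * W * h <= 1 &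
            4 / J2%:R <= 64 * n%:R * h]].
Proof.
move=> n0 tau0 tau1 B0 W0 P0.
have n1 : 1 <= n%:R :> R by rewrite (ler_nat R 1).
have [Z ZE] : exists Z, Z = 5 * n%:R + B + W + 1 by eexists.
have Z0 : 0 <= Z by lra.
(* Large enough for all conditions at once: [4 * P] gives the bound on [4 / J1 * P], and [16 * Z]
   makes [16 * Z * h <= 1] for the mesh [h] defined from [J1]. *)
pose J1 := (Num.truncn (5 + W + B + 1 + 4 * P + 16 * Z)).+1.
have J1gt : 5 + W + B + 1 + 4 * P + 16 * Z < J1%:R by exact: truncnS_gt.
have J10 : 0 < J1%:R :> R by rewrite ltr0n.
have nJ1 : J1%:R <= (n * J1)%:R :> R by rewrite natrM ler_peMl.
have J15 : (5 <= J1)%N by rewrite -(ler_nat R); lra.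
clearbody J1.
have nJ10 : 0 < (n * J1)%:R :> R by exact: lt_le_trans nJ1.
have [h hdef] : exists h, h = tau / (4 * (n * J1)%:R) by eexists.
have h0 : 0 < h by rewrite hdef divr_gt0// mulr_gt0.
have hE : 4 * (n * J1)%:R * h = tau.
  by rewrite hdef mulrC divfK// gt_eqF// mulr_gt0.
clear hdef.
have hZ : 16 * Z * h <= 1.
  have : 16 * Z * h <= (n * J1)%:R * h by rewrite ler_pM2r//; lra.
  lra.
have nh0 : 0 < 8 * n%:R * h by rewrite mulr_gt0// mulr_gt0// (lt_le_trans _ n1).
(* The largest integer with [8 * n * J2 * h <= 1]; maximality yields [16 * n * J2 * h >= 1], hence
   the bound on [4 / J2]. *)
pose J2 := Num.truncn (8 * n%:R * h)^-1.
have J2le : J2%:R <= (8 * n%:R * h)^-1 by rewrite truncn_le invr_ge0 ltW.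
have J2gt : (8 * n%:R * h)^-1 < J2%:R + 1 by rewrite natr1 truncnS_gt.
clearbody J2.
have J2h : 8 * (n * J2)%:R * h <= 1.
  move: J2le; rewrite -[_^-1]div1r ler_pdivlMr// natrM; clear; lra.
have J2h' : 1 < 8 * (n * J2)%:R * h + 8 * n%:R * h.
  move: J2gt; rewrite -[_^-1]div1r ltr_pdivrMr// natrM; clear; lra.
have nhZ : 80 * (n%:R * h) <= 1.
  have : 16 * (5 * n%:R) * h <= 16 * Z * h by rewrite ler_pM2r//; lra.
  clear -hZ; lra.
have WhZ : 16 * W * h <= 1.
  by apply: le_trans hZ; rewrite ler_pM2r//; lra.
have nJ2 : 1 <= 16 * (n * J2)%:R * h by clear -J2h' nhZ; lra.
have nJ2Z : Z <= (n * J2)%:R.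
  rewrite -(@ler_pM2r _ (16 * h)); first by clear -nJ2 hZ; lra.
  by rewrite mulr_gt0.
have J25 : (5 <= J2)%N.
  by rewrite -(leq_pmul2l n0) -(ler_nat R) natrM; lra.
have J20 : 0 < J2%:R :> R by rewrite ltr0n; exact: leq_trans J25.
exists h, J1, J2; split; [by []|split|split] => //; [lra|lra| |lra|lra|].
  by rewrite mulrAC ler_pdivrMr//; lra.
by rewrite ler_pdivrMr//; move: nJ2; rewrite natrM; clear; lra.
Qed.

(** With [tau = 4 * n * J1 * h] and boundary rate [4 / J1], the factor 256 makes the relative
    averaging error exactly [eps / 8]. The last bound amounts to [655360 * dl * n^2 * D <= eps^2],
    the source of the condition on [delta]. *)
Lemma scale_bounds (R : realType) (n : nat) (dl eps D : R) : (0 < n)%N ->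
  0 < dl -> 0 < eps < 1 -> 1 <= D ->
  1000 * (1000 * (dl * (n%:R ^+ 2 * D))) <= eps ^+ 2 ->
  let tau := 256 * n%:R * dl / eps in
  [/\ 0 < tau, tau <= 16^-1, 256 * dl <= tau & 2560 * n%:R * tau * D <= eps].
Proof.
move=> n_pos dl0 /andP[eps0 eps1] D1 small.
have n1 : 1 <= n%:R :> R by rewrite (ler_nat R 1).
have D0 : 0 < D by exact: lt_le_trans D1.
have n_gt0 : 0 < n%:R :> R by exact: lt_le_trans n1.
set tau := _ / _; have tauE : tau * eps = 256 * n%:R * dl by rewrite /tau divfK// gt_eqF.
have c0 : 0 < 256 :> R by rewrite ltr0n.
have tau0 : 0 < tau := divr_gt0 (mulr_gt0 (mulr_gt0 c0 n_gt0) dl0) eps0.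
clearbody tau.
have n2 : n%:R <= n%:R ^+ 2 :> R by rewrite expr2 ler_peMl// ltW.
have eps2 : eps ^+ 2 <= eps by rewrite expr2 ler_piMl// ltW.
have ndl1 : n%:R * dl <= dl * n%:R ^+ 2 * D.
  apply: (@le_trans _ _ (dl * n%:R ^+ 2)); first by rewrite mulrC ler_wpM2l// ltW.
  by rewrite ler_peMr// mulr_ge0// ?exprn_ge0// ltW.
have := small; rewrite [dl * (_ * D)]mulrA; set y := dl * _ * D in ndl1 *.
have yE : 2560 * n%:R * tau * D * eps = 2560 * (256 * y).
  rewrite -!mulrA [tau * _]mulrCA mulrA [tau * _]tauE /y; ring.
clearbody y => hy.
have y0 : 0 <= y by apply: le_trans ndl1; rewrite mulr_ge0// ltW.
split => //.
- by rewrite -(ler_pM2r eps0) tauE; move: ndl1 hy eps2 y0; clear; lra.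
- rewrite -(ler_pM2r eps0) tauE -[256 * dl * eps]mulrA -[256 * n%:R * dl]mulrA.
  rewrite (ler_pM2l c0) [leLHS]mulrC (ler_pM2r dl0).
  exact: ltW (lt_le_trans eps1 n1).
- rewrite -(ler_pM2r eps0) yE -expr2; apply: le_trans hy.
  by move: y0; clear; lra.
Qed.

(** * The embedding of the net read on the lattice *)

Section NetMap.
Variables (R : realType) (X V : normedModType R) (n : nat) (b : 'I_n -> X).
Variables (M : set X) (dl D : R) (p : X -> X) (f : X -> V).
Hypotheses (n0 : (0 < n)%N) (freeb : free_family b).
Hypotheses (dl0 : 0 < dl) (D1 : 1 <= D).
Hypothesis pM : forall x, `|x| <= 1 -> M (p x) /\ `|x - p x| <= dl.
Hypothesis f_bilip : forall x y, M x -> M y ->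
  `|x - y| / D <= `|f x - f y| /\ `|f x - f y| <= `|x - y|.

Local Notation A := {ffun 'I_n -> int}.

(** Rounding to the net moves each end by at most [dl], whence [2 * dl]; [h^-1] is the radius of the
    unit ball in mesh units. *)
Lemma net_map_upper (h : R) : 0 < h ->
  coarse_lipschitz (latpt b) h (2 * dl) h^-1 (fun k => f (p (h *: latpt b k))).
Proof.
move=> h0 k l kh lh; move: (dl0) => dl0'.
have ball (x : X) : `|x| <= h^-1 -> `|h *: x| <= 1.
  by move=> xh; rewrite normrZ gtr0_norm// mulrC -ler_pdivlMr// div1r.
have [pk hk] := pM (ball _ kh); have [pl hl] := pM (ball _ lh).
apply: le_trans (f_bilip pk pl).2 _.
set x := h *: latpt b k in pk hk *; set y := h *: latpt b l in pl hl *.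
have -> : h * `|latpt b (k - l)| = `|x - y|.
  by rewrite raddfB -scalerBr normrZ gtr0_norm.
have := ler_distD x (p x) (p y); have := ler_distD y x (p y).
by rewrite [`|p x - x|]distrC; lra.
Qed.

Lemma net_map_lower (h : R) (k l : A) : 0 < h ->
  `|latpt b k| <= h^-1 -> `|latpt b l| <= h^-1 ->
  (h * `|latpt b (k - l)| - 2 * dl) / D <=
  `|f (p (h *: latpt b k)) - f (p (h *: latpt b l))|.
Proof.
move=> h0 kh lh; move: (dl0) (D1) => dl0' D1'.
have ball (x : X) : `|x| <= h^-1 -> `|h *: x| <= 1.
  by move=> xh; rewrite normrZ gtr0_norm// mulrC -ler_pdivlMr// div1r.
have [pk hk] := pM (ball _ kh); have [pl hl] := pM (ball _ lh).
apply: le_trans (f_bilip pk pl).1.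
have D0 : 0 < D by lra.
rewrite ler_pM2r ?invr_gt0//.
set x := h *: latpt b k in pk hk *; set y := h *: latpt b l in pl hl *.
have -> : h * `|latpt b (k - l)| = `|x - y|.
  by rewrite raddfB -scalerBr normrZ gtr0_norm.
have := ler_distD (p x) x y; have := ler_distD (p y) (p x) y.
by rewrite [`|p y - y|]distrC; lra.
Qed.

Lemma lattice_small_boundary (J : nat) (L : R) : (5 <= J)%N ->
  \sum_(i < n) `|b i| <= (n * J)%:R -> L <= (n * J)%:R ->
  exists S r, [/\ small_boundary (latpt b) S r (4 / J%:R) L, 0 <= r & r <= 4 * (n * J)%:R].
Proof.
move=> J5 BJ LJ; have [r [_ rJ rP]] := regular_lattice_ball freeb n0 J5 BJ.
exists (lattice_ball freeb r), r%:R; split => //; last first.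
  by rewrite -[4]/(4%:R) -natrM ler_nat.
split.
- exact: lattice_ball_uniq.
- exact: lattice_ball_gt0.
- by move=> y; rewrite mem_lattice_ball.
- by move=> u uL; apply: rP; exact: le_trans uL LJ.
Qed.

End NetMap.

(** * Collecting the errors: bounds for the gradients *)

(** [N] stands for the norm of the lattice direction, [t] for the increment of [F] along it, [s] for
    [Q] times the norm of the gradient. A large [Q] absorbs the fixed errors [B] and [E]. *)
Lemma upper_budget (R : realType) (h eps D B E Q N s t : R) :
  0 < h -> 0 < eps < 1 -> 1 <= D -> 0 <= B -> 0 <= E ->
  8 * D * (2 * B + 1 + E) <= Q * eps -> N <= Q + B ->
  t <= h * (N + eps / 8 * (N + 1)) -> s <= t + h * E ->
  s <= Q * (h * (1 + eps)).
Proof.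
move=> h0 /andP[eps0 eps1] D1 B0 E0 QE NQ tN st.
have QE' : 8 * (2 * B + 1 + E) <= Q * eps.
  apply: le_trans QE; rewrite ler_wpM2r//; lra.
have N1 : N + eps / 8 * (N + 1) <= Q + B + eps / 8 * (Q + B + 1).
  by apply: lerD => //; rewrite ler_wpM2l//; lra.
have eB : eps / 8 * (B + 1) <= B + 1 by rewrite ler_piMl//; lra.
have tot : N + eps / 8 * (N + 1) + E <= Q * (1 + eps) by lra.
apply: le_trans st _; apply: (@le_trans _ _ (h * (N + eps / 8 * (N + 1) + E))).
  by rewrite mulrDr lerD2r.
by rewrite [leRHS]mulrCA ler_pM2l.
Qed.

(** The main term carries a factor [1 / D] but the error [h * E] does not, so [Q * eps] has to
    dominate [D * E]. *)
Lemma lower_budget (R : realType) (h eps D B E Q N la tau g : R) :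
  0 < h -> 0 < eps < 1 -> 1 <= D -> 0 <= B -> 0 <= E -> 0 <= la ->
  8 * D * (2 * B + 1 + E) <= Q * eps -> N <= Q + B -> Q - B <= N -> 0 <= N ->
  5 * g + 4 * tau <= 5 * tau -> la * (5 * tau) <= h * (eps / (8 * D)) ->
  Q * (h * ((1 - eps) / D)) <= h * N / D - la * (N + 1) * (5 * g + 4 * tau) - h * E.
Proof.
move=> h0 /andP[eps0 eps1] D1 B0 E0 la0 QE NQ QN N0 gtau latau.
have D0 : 0 < D by exact: lt_le_trans D1.
have err : la * (N + 1) * (5 * g + 4 * tau) <= h * (eps / (8 * D)) * (N + 1).
  apply: (@le_trans _ _ (la * (5 * tau) * (N + 1))); last by rewrite ler_wpM2r//; lra.
  by rewrite mulrAC; apply: ler_wpM2r; [rewrite addr_ge0|apply: ler_wpM2l].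
suff key : Q * (1 - eps) <= N - eps / 8 * (N + 1) - D * E.
  apply: (@le_trans _ _ (h / D * (N - eps / 8 * (N + 1) - D * E))).
    have -> : Q * (h * ((1 - eps) / D)) = h / D * (Q * (1 - eps)) by ring.
    by rewrite ler_pM2l// divr_gt0.
  have -> : h / D * (N - eps / 8 * (N + 1) - D * E) =
      h * N / D - h * (eps / (8 * D)) * (N + 1) - h * E.
    by field; rewrite gt_eqF.
  by rewrite lerD2r lerD2l lerN2.
have N1 : eps / 8 * (N + 1) <= eps / 8 * (Q + B + 1) by rewrite ler_wpM2l//; lra.
have eB : eps / 8 * (B + 1) <= B + 1 by rewrite ler_piMl//; lra.
have DB : 2 * B + 1 <= D * (2 * B + 1) by rewrite ler_peMl//; lra.
have DE : 0 <= D * E by rewrite mulr_ge0// ltW.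
move: QE N1 eB DB DE QN; clear -B0; lra.
Qed.

(* The direction [c] is approximated by the lattice direction [k / Q]. *)
Lemma gradient_estimates (R : realType) (X V : normedModType R) (n : nat)
    (e : {additive {ffun 'I_n -> int} -> X}) (B : R) (G : {ffun 'I_n -> int} -> V)
    (h dl eps D tau W L r1 r2 la1 la2 : R) (S1 S2 : seq {ffun 'I_n -> int})
    (c : 'I_n -> R) (k : {ffun 'I_n -> int}) (Q : R) :
  let F := smoothed G S1 in
  let m : R := (\sum_(i < n) `|k i|%N)%:R in
  let E := 1 + n%:R * (2 * B + 1) in
  (forall k, e k = 0 -> k = 0) -> 0 <= B -> (forall i, `|e (unitv i)| <= B) ->
  small_boundary e S1 r1 la1 L -> small_boundary e S2 r2 la2 L ->
  0 < h -> 0 < dl -> 0 < eps < 1 -> 1 <= D -> 0 <= la1 -> 0 <= la2 ->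
  2 * dl * la1 = h * (eps / 8) -> h * r1 <= tau -> W + 1 <= L -> B <= W ->
  r2 + 2 * W + 2 * r1 <= h^-1 ->
  coarse_lipschitz e h (2 * dl) h^-1 G ->
  (forall k l, `|e k| <= h^-1 -> `|e l| <= h^-1 ->
    (h * `|e (k - l)| - 2 * dl) / D <= `|G k - G l|) ->
  la1 * (8 * m * (2 * B + 1) * (W + 1)) <= 1 -> m * B <= W ->
  10 * dl + 4 * tau <= 5 * tau -> la2 * (5 * tau) <= h * (eps / (8 * D)) ->
  (forall i, 0 <= Q * c i - (k i)%:~R <= 1) ->
  `|e k| <= Q + B -> Q - B <= `|e k| -> Q + B <= W -> B < Q ->
  8 * D * (2 * B + 1 + E) <= Q * eps ->
  (forall w, w \in S2 -> `|gradient F w c| <= h * (1 + eps)) /\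
  h * ((1 - eps) / D) * (size S2)%:R <= \sum_(w <- S2) `|gradient F w c|.
Proof.
move=> F m E e_inj B0 eB S1_reg S2_reg h0 dl0 eps01 D1 la10 la20 sgE r1tau WL BW
  reg Gup Glow Pm mW gtau latau kc kQ Qk QW BQ QE.
have /andP[eps0 eps1] := eps01.
have Q0 : 0 < Q by exact: le_lt_trans BQ.
have g0 : 0 <= 2 * dl by rewrite mulr_ge0// ltW.
have sg0 : 0 <= eps / 8 by rewrite divr_ge0// ltW.
have sg1 : eps / 8 <= 1 by rewrite ler_pdivrMr// mul1r; apply: le_trans (ltW eps1) _; rewrite ler1n.
have E0 : 0 <= E by rewrite addr_ge0// mulr_ge0// addr_ge0// mulr_ge0.
have S2r : forall w, w \in S2 -> `|e w| <= r2 by case: S2_reg.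
have kW : `|e k| <= W by exact: le_trans kQ QW.
have W0 : 0 <= W by exact: le_trans BW.
have step w u : w \in S2 -> `|e u| <= W ->
    `|F (w + u) - F w| <= h * (`|e u| + eps / 8 * (`|e u| + 1)).
  move=> /S2r wr uW.
  apply: (smoothed_step e_inj S1_reg h0 g0 sgE WL reg Gup) => //.
  by apply: le_trans wr _; rewrite lerDl.
have ustep w i : w \in S2 -> `|F (w + unitv i) - F w| <= h * (2 * B + 1).
  move=> wS; apply: le_trans (step _ _ wS (le_trans (eB i) BW)) _.
  rewrite ler_pM2l//; have := eB i; set N := Num.norm _ => NB.
  have N0 : 0 <= N by exact: normr_ge0.
  have : eps / 8 * (N + 1) <= N + 1 by rewrite ler_piMl// addr_ge0.
  lra.
(* In [E], the summand 1 bounds the second differences along the word of [k], and [n * (2 * B + 1)]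
   the rounding of the coordinates. *)
have close w : w \in S2 -> `|Q *: gradient F w c - (F (w + k) - F w)| <= h * E.
  move=> wS; rewrite /E mulrDr mulr1 mulrCA.
  apply: gradient_close => // [i|]; first exact: ustep.
  have [vs [vsk szvs vsP]] := unitv_word k.
  have := smoothed_additive e_inj B0 eB S1_reg h0 g0 sg0 sg1 la10 sgE
    WL BW reg Gup (w := w) (T := igradient F w) (vs := vs).
  rewrite vsk szvs -/m -/F; move=> /(_ _ vsP (S2r _ wS) mW) H.
  apply: le_trans (H _) _; first by move=> i; exact: igradient_unitv.
  have -> : m * (2 * (2 * (h * (2 * B + 1)) * (la1 * (W + 1)))) =
    h * (la1 * (4 * m * (2 * B + 1) * (W + 1))) by ring.
  rewrite ger_pMr//; apply: le_trans Pm; rewrite ler_wpM2l//.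
  rewrite ler_wpM2r ?addr_ge0// ler_wpM2r ?addr_ge0 ?mulr_ge0//.
  by rewrite ler_wpM2r// ler_nat.
have nQ w : `|Q *: gradient F w c| = Q * `|gradient F w c|.
  by rewrite normrZ gtr0_norm.
split=> [w wS|].
  rewrite -(ler_pM2l Q0) -nQ.
  apply: (upper_budget (t := `|F (w + k) - F w|) h0 eps01 D1 B0 E0 QE kQ).
    exact: step.
  have := ler_distD (F (w + k) - F w) (Q *: gradient F w c) 0.
  by rewrite !subr0; have := close w wS; lra.
have k0 : k != 0.
  apply: contraTneq BQ => k0; rewrite -leNgt; move: Qk; rewrite k0 raddf0 normr0; lra.
have gtau' : 5 * (2 * dl) + 4 * tau <= 5 * tau by rewrite mulrA; apply: le_trans gtau; lra.
have low := smoothed_sum_ge e_inj B0 S1_reg S2_reg h0 g0 D1 r1tau WL BW reg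
  Gup Glow k0 kW.
have budget := lower_budget h0 eps01 D1 B0 E0 la20 QE kQ Qk (normr_ge0 _) gtau' latau.
rewrite -(ler_pM2l Q0) mulrA.
(* The increments along [k] are bounded below on average over [S2]; passing to [Q] times the
   gradient costs [h * E] at each point. *)
apply: (@le_trans _ _ (\sum_(w <- S2) (`|F (w + k) - F w| - h * E))).
  rewrite sumrB sumr_const_seq -[h * E *+ _]mulr_natl.
  rewrite [leLHS]mulrC; apply: le_trans (ler_wpM2l (ler0n _ _) budget) _.
  by rewrite mulrBr lerD2r.
rewrite mulr_sumr big_seq [leRHS]big_seq; apply: ler_sum => w wS.
rewrite -nQ; have := ler_distD (Q *: gradient F w c) (F (w + k) - F w) 0.
by rewrite !subr0 [`|_ - Q *: _|]distrC; have := close w wS; lra.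
Qed.

(** The parameters are fixed in the order [tau], [Q], [W], then the mesh [h] and the two balls, each
    depending only on earlier ones. Unit vectors are treated first and homogeneity gives the
    rest. *)
Lemma gradient_family (R : realType) (X V : normedModType R) (n : nat)
    (b : 'I_n -> X) (co : X -> 'I_n -> R) (M : set X) (dl eps D : R)
    (p : X -> X) (f : X -> V) :
  (0 < n)%N -> free_family b -> (forall x, x = \sum_(i < n) co x i *: b i) ->
  0 < dl -> 0 < eps < 1 -> 1 <= D ->
  1000 * (1000 * (dl * (n%:R ^+ 2 * D))) <= eps ^+ 2 ->
  (forall x, `|x| <= 1 -> M (p x) /\ `|x - p x| <= dl) ->
  (forall x y, M x -> M y ->
    `|x - y| / D <= `|f x - f y| /\ `|f x - f y| <= `|x - y|) ->
  exists (h : R) (F : {ffun 'I_n -> int} -> V) (S : seq {ffun 'I_n -> int}),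
    [/\ 0 < h, (0 < size S)%N,
      forall x w, w \in S -> `|gradient F w (co x)| <= h * (1 + eps) * `|x| &
      forall x, h * ((1 - eps) / D) * `|x| * (size S)%:R <=
        \sum_(w <- S) `|gradient F w (co x)|].
Proof.
move=> n0 freeb coE dl0 eps01 D1 small pM f_bilip.
have [C [C0 Cb]] := free_family_coord_bound freeb.
have [tau0 tau1 tau_dl tauD] := scale_bounds n0 dl0 eps01 D1 small.
set tau := 256 * n%:R * dl / eps in tau0 tau1 tau_dl tauD; clear small.
have tauE : tau * eps = 256 * n%:R * dl.
  by rewrite /tau divfK//; case/andP: eps01 => /gt_eqF ->.
clearbody tau.
have /andP[eps0 eps1] := eps01.
have D0 : 0 < D by exact: lt_le_trans D1.
have n1 : 0 <= n%:R :> R by [].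
have n_gt0 : 0 < n%:R :> R by rewrite ltr0n.
have [B BE] : exists B, B = \sum_(i < n) `|b i| by eexists.
have B0 : 0 <= B by rewrite BE; exact: sumr_ge0.
have [E EE] : exists E, E = 1 + n%:R * (2 * B + 1) :> R by eexists.
have E0 : 0 <= E by rewrite EE addr_ge0// mulr_ge0// addr_ge0// mulr_ge0.
have [Q QE] : exists Q, Q = 8 * D * (2 * B + 1 + E) / eps + B + 1 by eexists.
have big0 : 0 <= 8 * D * (2 * B + 1 + E).
  by rewrite !mulr_ge0 ?addr_ge0 ?mulr_ge0// ltW.
have BQ : B < Q by rewrite QE; have := divr_ge0 big0 (ltW eps0); clear; lra.
have Q0 : 0 <= Q by exact: le_trans B0 (ltW BQ).
have Qeps : 8 * D * (2 * B + 1 + E) <= Q * eps.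
  by rewrite -ler_pdivrMr// QE -[_ / eps + B + 1]addrA lerDl addr_ge0.
have [m mE] : exists m, m = n%:R * (Q * C + 1) by eexists.
have m0 : 0 <= m by rewrite mE mulr_ge0// addr_ge0// mulr_ge0// ltW.
(* [W] dominates the length of the word times [B], the norm [Q + B] of the lattice direction, and
   [B]. *)
have [W WE] : exists W, W = m * B + Q + B by eexists.
have mB0 : 0 <= m * B by rewrite mulr_ge0.
have W0 : 0 <= W by rewrite WE !addr_ge0.
have P0 : 0 <= 8 * m * (2 * B + 1) * (W + 1).
  by rewrite !mulr_ge0 ?addr_ge0 ?mulr_ge0.
have [|h [J1 [J2 [h0 [J15 BJ1 WJ1 hJ1 PJ1] [J25 BJ2 WJ2 [hJ2 hW] la2h]]]]] :=
  scale_choice n0 tau0 _ B0 W0 P0; first by apply: le_trans tau1 _; rewrite invf_le1 ?ltr0n// ler1n.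
have J10 : 0 < J1%:R :> R by rewrite ltr0n; exact: leq_trans J15.
rewrite BE in BJ1 BJ2.
have [S1 [r1 [S1_reg r10 r1J]]] := lattice_small_boundary n0 freeb J15 BJ1 WJ1.
have [S2 [r2 [S2_reg r20 r2J]]] := lattice_small_boundary n0 freeb J25 BJ2 WJ2.
have hr1 : h * r1 <= tau by rewrite -hJ1 mulrC ler_pM2r.
have reg : r2 + 2 * W + 2 * r1 <= h^-1.
  rewrite -[h^-1]div1r ler_pdivlMr//.
  have : r2 * h <= 4 * (n * J2)%:R * h by rewrite ler_pM2r.
  by move: hr1 hJ2 hW tau1; clear; lra.
have Gup := net_map_upper (b := b) dl0 pM f_bilip h0.
have Glow k l := net_map_lower (b := b) (k := k) (l := l) dl0 D1 pM f_bilip h0.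
set G := (fun k => f _) in Gup.
have S20 : (0 < size S2)%N by case: S2_reg.
exists h, (smoothed G S1), S2.
have unit_est x : `|x| = 1 ->
  (forall w, w \in S2 -> `|gradient (smoothed G S1) w (co x)| <= h * (1 + eps)) /\
  h * ((1 - eps) / D) * (size S2)%:R <= \sum_(w <- S2) `|gradient (smoothed G S1) w (co x)|.
  move=> x1.
  have cC i : `|co x i| <= C by have := Cb (co x) i; rewrite -coE x1 mulr1.
  have [|k [kc kQ Qk km]] := @lattice_direction R X n b (co x) Q C _ Q0 cC.
    by rewrite -coE.
  rewrite -BE in kQ Qk; rewrite -mE in km.
  have kW : (\sum_(i < n) `|k i|%N)%:R * B <= W.
    by apply: le_trans (ler_wpM2r B0 km) _; rewrite WE; clear -Q0 B0; lra.
  apply: (gradient_estimates (e := latpt b) (B := B) (dl := dl) (tau := tau)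
    (W := W) (L := W + 1) (r1 := r1) (r2 := r2) (la1 := 4 / J1%:R) (la2 := 4 / J2%:R)
    (k := k) (Q := Q)) => //.
  - exact: latpt_inj.
  - by move=> i; rewrite /= latpt_unitv BE (bigD1 i)//= lerDl sumr_ge0.
  (* This identity is the equation [2 * dl * (4 / J1) = h * (eps / 8)] with denominators cleared. *)
  - have hJ : h * eps * J1%:R = 64 * dl.
      apply: (mulfI (lt0r_neq0 n_gt0)).
      move: tauE; rewrite -hJ1 natrM; clear; lra.
    apply: (mulIf (lt0r_neq0 J10)); rewrite -[2 * dl * _ * _]mulrA divfK ?lt0r_neq0//.
    by move: hJ; clear; lra.
  - by rewrite WE lerDr addr_ge0.
  - apply: le_trans PJ1; rewrite ler_wpM2l ?divr_ge0//.
    rewrite ler_wpM2r ?addr_ge0// ler_wpM2r ?addr_ge0 ?mulr_ge0//.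
    by rewrite ler_wpM2l.
  - by move: tau_dl dl0; clear; lra.
  (* The boundary rate of [S2] is at most [64 * n * h], so the claim reduces to
     [2560 * n * tau * D <= eps]. *)
  - apply: (@le_trans _ _ (64 * n%:R * h * (5 * tau))).
      by rewrite ler_wpM2r// mulr_ge0// ltW.
    have -> : 64 * n%:R * h * (5 * tau) = h * (320 * n%:R * tau) by ring.
    rewrite ler_pM2l// ler_pdivlMr ?mulr_gt0//.
    by move: tauD; clear; lra.
  - by rewrite WE -addrA lerDr.
  - by rewrite -EE.
have coZ a x i : co (a *: x) i = a * co x i.
  apply/eqP; rewrite -subr_eq0; apply/eqP.
  apply: (freeb (fun j => co (a *: x) j - a * co x j)).
  under eq_bigr do rewrite scalerBl -scalerA.
  by rewrite sumrB -scaler_sumr -!coE subrr.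
have gradZ x w : x != 0 -> `|gradient (smoothed G S1) w (co x)| =
    `|gradient (smoothed G S1) w (co (`|x|^-1 *: x))| * `|x|.
  move=> x0; have nx : `|x| != 0 by rewrite normr_eq0.
  have -> : gradient (smoothed G S1) w (co x) =
      `|x| *: gradient (smoothed G S1) w (co (`|x|^-1 *: x)).
    rewrite /gradient scaler_sumr; apply: eq_bigr => i _.
    by rewrite scalerA coZ mulVKf.
  by rewrite normrZ normr_id mulrC.
have unit (x : X) : x != 0 -> `|(`|x|^-1 *: x)| = 1.
  by move=> x0; rewrite normrZ ger0_norm ?invr_ge0// mulVf// normr_eq0.
split => // [x w wS|x]; have [->|x0] := eqVneq x 0.
- have co0 : gradient (smoothed G S1) w (co 0) = 0.
    rewrite /gradient big1// => i _.
    by rewrite -(scale0r (0 : X)) coZ mul0r scale0r.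
  by rewrite co0 !normr0 mulr0.
- rewrite gradZ// ler_wpM2r//; exact: (unit_est _ (unit x x0)).1.
- by rewrite normr0 mulr0 mul0r sumr_ge0.
- under eq_bigr do rewrite gradZ//.
  rewrite -mulr_suml mulrAC ler_wpM2r//; exact: (unit_est _ (unit x x0)).2.
Qed.

(** * A finite probability space *)

Section UniformSegment.
Variables (R : realType) (k : nat).

(** The uniform measure on [{0, ..., k}], carried by [nat], where every set is measurable. *)
Definition uniform_segment : set nat -> \bar R :=
  mscale (k.+1%:R^-1)%:nng (msum (fun i : nat => \d_i) k.+1).

HB.instance Definition _ := Measure.on uniform_segment.

Lemma uniform_segmentE (S : set nat) :
  uniform_segment S = (k.+1%:R^-1%:E * \sum_(i < k.+1) \d_(i : nat) S)%E.
Proof. by []. Qed.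

Lemma uniform_segmentT : uniform_segment setT = 1%E.
Proof.
rewrite uniform_segmentE; under eq_bigr do rewrite diracT.
by rewrite sumEFin sumr_const card_ord -EFinM mulVf.
Qed.

HB.instance Definition _ :=
  Measure_isProbability.Build _ _ R uniform_segment uniform_segmentT.

Lemma uniform_segment_eq0 (S : set nat) :
  (forall i, (i < k.+1)%N -> ~ S i) -> uniform_segment S = 0%E.
Proof.
move=> SN; rewrite uniform_segmentE big1 ?mule0// => i _.
by rewrite diracE memNset//; exact: SN.
Qed.

Lemma integral_uniform_segment (f : nat -> R) : (forall i, 0 <= f i) ->
  (\int[uniform_segment]_i (f i)%:E = (k.+1%:R^-1 * \sum_(i < k.+1) f i)%:E)%E.
Proof.
move=> f0.
rewrite /uniform_segment ge0_integral_mscale//; last by move=> i _; rewrite lee_fin.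
rewrite ge0_integral_measure_sum//; last by move=> i _; rewrite lee_fin.
rewrite EFinM -sumEFin; congr (_ * _)%E; apply: eq_bigr => i _.
by rewrite integral_dirac// diracT mul1e.
Qed.
End UniformSegment.

(** The finite sets of naturals, enumerated by their codes, are dense: any set agrees on the support
    with a finite one. Codes of nothing stand for the empty set. *)
Lemma separable_uniform_segment (k : nat) : separable_prob (uniform_segment RR k).
Proof.
exists (fun m => [set i | i \in odflt [::] (unpickle m : option (seq nat))]); split => //.
move=> S _ e e0.
have [l lE] : exists l : seq nat, forall i, (i \in l) = (i \in S) && (i < k.+1)%N.
  by exists [seq i <- iota 0 k.+1 | i \in S] => i; rewrite mem_filter mem_iota.
exists (pickle l); rewrite pickleK [X in (X < _)%E](_ : _ = 0%E) ?lte_fin//.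
apply: uniform_segment_eq0 => i ik [[]|[]] /=; rewrite lE ik andbT.
  by rewrite inE.
by move=> iS; rewrite mem_set.
Qed.

Lemma L1norm_le_Linfnorm (k : nat) (Y : normedModType RR) (f : nat -> Y) :
  (L1norm (uniform_segment RR k) f <= Linfnorm (uniform_segment RR k) f)%E.
Proof.
set P := uniform_segment RR k; have PT : P setT = 1%E := probability_setT P.
have P0 : (0 < P setT)%E by rewrite PT lte01.
have M0 : (0 <= Linfnorm P f)%E.
  by apply: ess_sup_gee; [exact: P0|apply: aeW => w; rewrite lee_fin].
rewrite -[leRHS]mule1 -PT -integral_cst//.
apply: ae_ge0_le_integral => //.
have [N [mN N0 subN]] := ess_sup_ge P (fun w => (`|f w|)%:E).
exists N; split => // w fw; apply: subN => fw'; exact: fw.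
Qed.

(** [d i j] is the value at the sample point [i] on the [j]-th basis vector, and the
    finite-dimensional target is spanned by all of these. *)
Lemma operator_of_finite_family (X Y : normedModType RR) (n k : nat)
    (co : X -> 'I_n -> RR) (d : 'I_k.+1 -> 'I_n -> Y) (lo up : RR) :
  (forall a x y i, co (a *: x + y) i = a * co x i + co y i) ->
  (forall i x, `|\sum_(j < n) co x j *: d i j| <= up * `|x|) ->
  (forall x, lo * `|x| * k.+1%:R <= \sum_(i < k.+1) `|\sum_(j < n) co x j *: d i j|) ->
  exists (d : measure_display) (T : measurableType d) (P : probability T RR),
    separable_prob P /\
    exists (m : nat) (z : 'I_m -> Y) (Top : X -> T -> Y),
      (forall x w, span_fin z (Top x w)) /\
      (forall x, vmeasurable (Top x)) /\
      (forall (a : RR) (x y : X),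
          {ae P, forall w, Top (a *: x + y) w = a *: Top x w + Top y w}) /\
      (forall x : X,
          ((lo * `|x|)%:E <= L1norm P (Top x))%E /\
          (L1norm P (Top x) <= Linfnorm P (Top x))%E /\
          (Linfnorm P (Top x) <= (up * `|x|)%:E)%E).
Proof.
move=> co_lin upper lower.
(* [inord] sends the points outside the support of the measure to [0], so that the
   pointwise bounds hold everywhere. *)
pose Top x (w : nat) := \sum_(j < n) co x j *: d (inord w) j.
exists _, nat, (uniform_segment RR k); split; first exact: separable_uniform_segment.
pose I : finType := ('I_k.+1 * 'I_n)%type.
exists #|{: I}|, (fun q => d (enum_val q).1 (enum_val q).2), Top; split; [|split; [|split]].
(* At [w] only the pairs with first entry [inord w] receive a nonzero coefficient. *)
- move=> x w; pose c (ij : I) := if ij.1 == inord w then co x ij.2 else 0.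
  exists (fun q => c (enum_val q)).
  rewrite -(big_enum_val (A := {: I}) (fun ij => c ij *: d ij.1 ij.2))/=.
  rewrite (eq_bigl xpredT)//.
  rewrite -(pair_bigA _ (fun i j => (if i == inord w then co x j else 0) *: d i j))/=.
  rewrite (bigD1 (inord w))//= [X in _ + X]big1 ?addr0 => [|i iw].
    by apply: eq_bigr => j _; rewrite eqxx.
  by rewrite big1// => j _; rewrite (negPf iw) scale0r.
- by move=> x U _.
- move=> a x y; apply: aeW => w; rewrite /Top scaler_sumr -big_split.
  by apply: eq_bigr => j _; rewrite /= co_lin scalerDl scalerA.
- move=> x; split; [|split].
  + rewrite /L1norm integral_uniform_segment// lee_fin [leRHS]mulrC ler_pdivlMr ?ltr0n//.
    apply: le_trans (lower x) _.
    by rewrite le_eqVlt; apply/orP; left; apply/eqP/eq_bigr => i _; rewrite /Top inord_val.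
  + exact: L1norm_le_Linfnorm.
  + by apply/ess_supP; apply: aeW => w; rewrite lee_fin; exact: upper.
Qed.

(** * Coordinates, distortion and assembly of the operator *)

Lemma dim_eq_coordinates (X : normedModType RR) (n : nat) : dim_eq X n ->
  exists (b : 'I_n -> X) (co : X -> 'I_n -> RR),
    [/\ free_family b, forall x, x = \sum_(i < n) co x i *: b i &
      forall a x y i, co (a *: x + y) i = a * co x i + co y i].
Proof.
case=> b bP.
have [co coE] : {co : X -> 'I_n -> RR & forall x, x = \sum_(i < n) co x i *: b i}.
  by apply: (@choice _ _ (fun x c => x = \sum_(i < n) c i *: b i)) => x;
    have [c [cE _]] := bP x; exists c.
have freeb : free_family b.
  move=> c c0 i; have [c' [_ c'_uniq]] := bP 0.
  rewrite -(c'_uniq c (esym c0)) (c'_uniq (fun=> 0))//.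
  by rewrite big1// => j _; rewrite scale0r.
exists b, co; split => // a x y i; apply/eqP; rewrite -subr_eq0; apply/eqP.
apply: (freeb (fun j => co (a *: x + y) j - (a * co x j + co y j))).
under eq_bigr do rewrite scalerBl scalerDl -scalerA.
by rewrite sumrB big_split /= -scaler_sumr -!coE subrr.
Qed.

(** The infimum need not be attained, hence the strict margin [D']; dividing by [Dd * s] makes the
    embedding 1-Lipschitz. *)
Lemma distortion_embedding (X Y : normedModType RR) (M : set X) (D D' : RR) :
  (distortion Y M <= D%:E)%E -> D < D' ->
  exists (Dd : RR) (f : X -> Y), [/\ 1 <= Dd, Dd < D' &
    forall x y, M x -> M y ->
      `|x - y| / Dd <= `|f x - f y| /\ `|f x - f y| <= `|x - y|].
Proof.
move=> dD DD'; have : (distortion Y M < D'%:E)%E by apply: le_lt_trans dD _; rewrite lte_fin.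
case/ereal_inf_lt => _ [Dd [Dd1 [g [s [s0 gP]]]] <-]; rewrite lte_fin => DdD'.
have Dd0 : 0 < Dd by exact: lt_le_trans Dd1.
have Ds0 : 0 < Dd * s by exact: mulr_gt0.
exists Dd, (fun x => (Dd * s)^-1 *: g x); split => // x y Mx My.
rewrite -scalerBr normrZ gtr0_norm ?invr_gt0//.
have [g1 g2] := gP x y Mx My; split.
  have -> : `|x - y| / Dd = (Dd * s)^-1 * (s * `|x - y|).
    by rewrite invfM -mulrA mulKf ?gt_eqF// mulrC.
  by rewrite ler_pM2l ?invr_gt0.
by rewrite ler_pdivrMl.
Qed.

Theorem theorem1p2 :
  exists kappa : RR, 0 < kappa /\
  forall (n : nat) (delta eps D : RR) (X Y : completeNormedModType RR) (N : set X),
    0 < delta < 1 -> 0 < eps < 1 -> 1 <= D ->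
    delta * ((n%:R) ^+ 2 * D) <= kappa * eps ^+ 2 ->
    dim_eq X n -> is_net delta N -> (distortion Y N <= D%:E)%E ->
    exists (d : measure_display) (T : measurableType d) (P : probability T RR),
      separable_prob P /\
      exists (m : nat) (z : 'I_m -> Y) (Top : X -> T -> Y),
        (forall x w, span_fin z (Top x w)) /\
        (forall x, vmeasurable (Top x)) /\
        (forall (a : RR) (x y : X),
            {ae P, forall w, Top (a *: x + y) w = a *: Top x w + Top y w}) /\
        (forall x : X,
            (((1 - eps) / D * `|x|)%:E <= L1norm P (Top x))%E /\
            (L1norm P (Top x) <= Linfnorm P (Top x))%E /\
            (Linfnorm P (Top x) <= ((1 + eps) * `|x|)%:E)%E).
Proof.
have K0 : 0 < 1000 * (1000 * 8) :> RR by rewrite mulr_gt0 ?mulr_gt0 ?ltr0n.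
(* The factor 8 is 4 from replacing [eps] by [eps / 2] in the square, times 2 from [Dd <= 2 * D]. *)
exists (1000 * (1000 * 8))^-1; split; first by rewrite invr_gt0.
move=> n delta eps D X Y N /andP[delta0 _] /andP[eps0 eps1] D1 small dimX [_ net] distN.
have [b [co [freeb coE co_lin]]] := dim_eq_coordinates dimX.
(* In dimension zero all norms vanish and the zero operator serves. *)
have [n0|n_gt0] := posnP n.
  have x0 (x : X) : `|x| = 0.
    by rewrite [x]coE big1 ?normr0// => i; have := leq_trans (ltn_ord i) (eq_leq n0).
  apply: (@operator_of_finite_family _ _ n 0 co (fun _ _ => 0)) => //.
    by move=> i x; rewrite big1 ?normr0 ?x0 ?mulr0// => j _; rewrite scaler0.
  by move=> x; rewrite x0 mulr0 mul0r sumr_ge0.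
have D0 : 0 < D by exact: lt_le_trans D1.
(* The margin [1 + eps / 4] is recovered by building the gradients with [eps / 2]. *)
have [|Dd [f [Dd1 DdD fP]]] := distortion_embedding (D' := D * (1 + eps / 4)) distN.
  by rewrite ltr_pMr// ltrDl divr_gt0.
have Dd0 : 0 < Dd by exact: lt_le_trans Dd1.
have Dd2 : Dd <= 2 * D.
  apply: le_trans (ltW DdD) _; rewrite mulrC ler_pM2r//; move: eps1; clear; lra.
have [p pP] : {p : X -> X & forall x, `|x| <= 1 -> N (p x) /\ `|x - p x| <= delta}.
  apply: (@choice _ _ (fun x y => `|x| <= 1 -> N y /\ `|x - y| <= delta)) => x.
  (* Outside the unit ball the implication is vacuous and [0] is a dummy witness. *)
  have [x1|x1] := pselect (`|x| <= 1); last by exists 0.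
  by have [y Ny xy] := net x x1; exists y.
have eps'01 : 0 < eps / 2 < 1.
  by rewrite divr_gt0//= ltr_pdivrMr// mul1r (lt_trans eps1)// ltr1n.
have small' : 1000 * (1000 * (delta * (n%:R ^+ 2 * Dd))) <= (eps / 2) ^+ 2.
  have dDd : delta * (n%:R ^+ 2 * Dd) <= 2 * (delta * (n%:R ^+ 2 * D)).
    by rewrite [leRHS]mulrCA ler_pM2l// [leRHS]mulrCA ler_wpM2l// exprn_ge0.
  move: small; rewrite ler_pdivlMl// expr_div_n.
  rewrite -[X in X <= _]mulrA -[1000 * 8 * _]mulrA.
  set y := delta * (_ * D) in dDd *; set y' := delta * _ in dDd *.
  set K : RR := 1000; have K'0 : 0 <= K by rewrite /K ler0n.
  clearbody y y' K => hy.
  have : K * (K * y') <= K * (K * (2 * y)) by rewrite !ler_wpM2l.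
  by move: hy; clear; lra.
have [h [F [S [h0 S0 upF loF]]]] := gradient_family n_gt0 freeb coE delta0 eps'01 Dd1
  small' pP fP.
have [k kS] : exists k, size S = k.+1 by exists (size S).-1; rewrite prednK.
pose s (i : 'I_k.+1) := nth 0 S i.
have sS i : s i \in S by rewrite mem_nth// kS.
have sumS (phi : {ffun 'I_n -> int} -> RR) : \sum_(w <- S) phi w = \sum_(i < k.+1) phi (s i).
  by rewrite (big_nth 0) kS big_mkord.
have TE x w : \sum_(j < n) co x j *: (h^-1 *: (F (w + unitv j) - F w)) =
    h^-1 *: gradient F w (co x).
  by rewrite scaler_sumr; apply: eq_bigr => j _; rewrite !scalerA mulrC.
(* Dividing by the mesh [h] turns differences over one lattice step into difference quotients. *)
apply: (@operator_of_finite_family _ _ n k co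
  (fun i j => h^-1 *: (F (s i + unitv j) - F (s i)))) => //.
  move=> i x; rewrite TE normrZ gtr0_norm ?invr_gt0// ler_pdivrMl// mulrA.
  apply: le_trans (upF x _ (sS i)) _; rewrite ler_wpM2r// ler_pM2l//.
  by move: eps0; clear; lra.
move=> x; under eq_bigr do rewrite TE normrZ gtr0_norm ?invr_gt0//.
rewrite -mulr_sumr -(sumS (fun w => `|gradient F w (co x)|)) ler_pdivlMl//.
rewrite -kS !mulrA; apply: le_trans (loF x); rewrite !ler_wpM2r//.
rewrite -mulrA ler_pM2l// ler_pdivrMr// mulrAC ler_pdivlMr//.
(* The lower bound closes by [(1 - eps) * (1 + eps / 4) <= 1 - eps / 2]. *)
have step : (1 - eps) * Dd <= (1 - eps) * (D * (1 + eps / 4)).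
  by rewrite ler_wpM2l ?ltW// subr_gt0.
apply: le_trans step _; rewrite mulrCA [leRHS]mulrC ler_pM2l//.
have : 0 <= eps ^+ 2 by rewrite sqr_ge0.
by move: eps0; clear; lra.
Qed.
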